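(* Let $A,B$ be constant real $d\times d$ matrices and let $f:\mathbb{R}^d\times\mathcal{P}_2(\mathbb{R}^d)\to\mathbb{R}^d$ be given by $f(x,m)=Ax+\int_{\mathbb{R}^d}By\,m(dy)$, $f$ being Lipschitz continuous in the sense that for some constant $C_0$, $\|f(x,\mu)-f(y,\nu)\|\le C_0(\|x-y\|+W_2(\mu,\nu))$ for all $x,y\in\mathbb{R}^d$, $\mu,\nu\in\mathcal{P}_2(\mathbb{R}^d)$. Let $\hat m\in\mathcal{P}_2(\mathbb{R}^d)$ be an equilibrium of the non-local continuity equation $\partial_tm_t+\operatorname{div}(f(x,m_t)m_t)=0$ which is absolutely continuous with respect to the Lebesgue measure. Assume that for every $\xi\in\operatorname{Tan}(\hat m)\setminus\{0\}$ $$\int_{\mathbb{R}^d}\xi(\hat x)^\top A\,\xi(\hat x)\,\hat m(d\hat x)+\Big(\int_{\mathbb{R}^d}\xi(\hat x)^\top\hat m(d\hat x)\Big)\,B\,\Big(\int_{\mathbb{R}^d}\xi(\hat y)\,\hat m(d\hat y)\Big)\le0.$$ Then the equilibrium $\hat m$ is stable.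
   Context: $\mathcal{P}_2(\mathbb{R}^d)$ is the space of Borel probability measures on $\mathbb{R}^d$ with finite second moment, with the Wasserstein metric $W_2$. $\operatorname{Tan}(\hat m)$, the tangent space to $\mathcal{P}_2(\mathbb{R}^d)$ at $\hat m$, is the closure in $L_2(\hat m)$ of the set of gradients $\{\nabla\varphi:\varphi\in C_c^\infty(\mathbb{R}^d)\}$; its elements are regarded as column-vector-valued functions (identifying row and column vectors by transposition). Solution: a continuous curve $m_\cdot:[0,T]\to\mathcal{P}_2(\mathbb{R}^d)$ is a solution of the continuity equation on $[0,T]$ if $\int_0^T\int_{\mathbb{R}^d}(\partial_t\varphi(x,t)+\nabla_x\varphi(x,t)\cdot f(x,m_t))\,m_t(dx)\,dt=0$ for every $\varphi\in C_c^\infty(\mathbb{R}^d\times(0,T);\mathbb{R})$. (Under the Lipschitz condition, for every $m_*\in\mathcal{P}_2(\mathbb{R}^d)$ there is a unique solution with $m_0=m_*$, defined on all of $[0,\infty)$.) Equilibrium: $\hat m$ is an equilibrium if $m_t\equiv\hat m$ is a solution, equivalently $\operatorname{div}(f(x,\hat m)\hat m)=0$ in the sense of distributions. Stable: for every $\varepsilon>0$ there is $\delta>0$ such that if $m_*\in\mathcal{P}_2(\mathbb{R}^d)$, $W_2(\hat m,m_* )<\delta$, $t>0$, and $m_\cdot$ is the solution with $m_0=m_*$, then $W_2(\hat m,m_t)<\varepsilon$. *)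

(* Defs.v *)
From HB Require Import structures.
From mathcomp Require Import all_boot all_order all_algebra.
From mathcomp Require Import all_classical all_reals all_analysis.

Set Implicit Arguments.
Unset Strict Implicit.
Unset Printing Implicit Defensive.

Import Order.TTheory GRing.Theory Num.Theory.
Import numFieldNormedType.Exports.

Local Open Scope classical_set_scope.
Local Open Scope ring_scope.

(* Borel sigma-algebra; in particular on R^d, represented by 'cV[R]_d. *)
HB.instance Definition _ (R : realType) (m n : nat) :=
  @isMeasurable.Build (sigma_display (@open 'M[R]_(m, n))) 'M[R]_(m, n)
    <<s @open 'M[R]_(m, n) >> (@sigma_algebra0 _ setT _) (@sigma_algebraC _ _)
    (@sigma_algebra_bigcup _ setT _).

Definition dot {R : realType} {d : nat} (u v : 'cV[R]_d) : R :=
  (u^T *m v) ord0 ord0.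

(* The library's norm on 'cV[R]_d is the sup norm: it induces the usual
   topology, but W_2 and L_2 need the Euclidean norm. *)
Definition enorm {R : realType} {d : nat} (u : 'cV[R]_d) : R :=
  Num.sqrt (dot u u).

Definition vint {R : realType} {d : nat} (mu : {measure set 'cV[R]_d -> \bar R})
    (g : 'cV[R]_d -> 'cV[R]_d) : 'cV[R]_d :=
  \col_i (\int[mu]_x g x i ord0).

Definition box {R : realType} {d : nat} (a b : 'cV[R]_d) : set 'cV[R]_d :=
  [set x | forall i, a i ord0 <= x i ord0 <= b i ord0].

Definition box_volume {R : realType} {d : nat} (a b : 'cV[R]_d) : R :=
  \prod_(i < d) Num.max 0 (b i ord0 - a i ord0).

(* Outer measure, by finite or countable covers with closed boxes; on Borel
   sets it is the Lebesgue measure. *)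
Definition lebesgue_cV {R : realType} {d : nat} (X : set 'cV[R]_d) : \bar R :=
  ereal_inf [set s | exists (D : set nat) (a b : nat -> 'cV[R]_d),
    X `<=` \bigcup_(k in D) box (a k) (b k) /\
    s = \esum_(k in D) (box_volume (a k) (b k))%:E].

Record P2 (R : realType) (d : nat) := MkP2 {
  P2_law :> probability 'cV[R]_d R ;
  P2_moment : (\int[P2_law]_x ((enorm x) ^+ 2)%:E < +oo)%E }.

Definition coupling {R : realType} {d : nat} (mu nu : probability 'cV[R]_d R)
    : set (probability ('cV[R]_d * 'cV[R]_d)%type R) :=
  [set gamma | forall E : set 'cV[R]_d, measurable E ->
    gamma (E `*` setT) = mu E /\ gamma (setT `*` E) = nu E].

(* On P2 the infimum is finite, being at most the cost of the product
   coupling, so [fine] loses nothing. *)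
Definition W2 {R : realType} {d : nat} (mu nu : P2 R d) : R :=
  Num.sqrt (fine (ereal_inf
    [set (\int[gamma]_z ((enorm (z.1 - z.2)) ^+ 2)%:E)%E
      | gamma in coupling mu nu])).

(* Class C^n, for finite-dimensional V only: there, f is C^(k+1) iff it is
   differentiable and each 'D_v f = 'd f _ v is C^k. *)
Fixpoint class_C {R : realType} {V : normedModType R} (n : nat) (f : V -> R)
    : Prop :=
  if n is k.+1 then
    (forall x, differentiable f x) /\ (forall v : V, class_C k ('D_v f))
  else continuous f.

Definition support_closure {R : realType} {V : normedModType R} (f : V -> R)
    : set V :=
  closure [set x | f x != 0].

Definition Cc_infty {R : realType} {V : normedModType R} (f : V -> R) : Prop :=
  (forall n, class_C n f) /\ compact (support_closure f).

Definition grad {R : realType} {d : nat} (phi : 'cV[R]_d -> R) (x : 'cV[R]_d)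
    : 'cV[R]_d :=
  \col_i ('D_(delta_mx i ord0) phi x).

Definition L2norm {R : realType} {d : nat}
    (mu : {measure set 'cV[R]_d -> \bar R}) (g : 'cV[R]_d -> 'cV[R]_d) : \bar R :=
  Lnorm mu 2%:E (fun x => (enorm (g x))%:E).

Definition in_L2 {R : realType} {d : nat}
    (mu : {measure set 'cV[R]_d -> \bar R}) (g : 'cV[R]_d -> 'cV[R]_d) : Prop :=
  measurable_fun setT g /\ (L2norm mu g < +oo)%E.

(* Elements of L_2(mu) are given by representatives. *)
Definition Tan {R : realType} {d : nat}
    (mu : {measure set 'cV[R]_d -> \bar R}) (xi : 'cV[R]_d -> 'cV[R]_d) : Prop :=
  in_L2 mu xi /\
  forall eps : R, 0 < eps -> exists phi : 'cV[R]_d -> R,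
    Cc_infty phi /\ (L2norm mu (fun x => xi x - grad phi x)%R < eps%:E)%E.

(* Elements of C_c^infty(R^d x (0,T)), extended by zero. *)
Definition test_function {R : realType} {d : nat} (T : R)
    (phi : 'cV[R]_d * R -> R) : Prop :=
  Cc_infty phi /\
  support_closure phi `<=` [set z | 0 < z.2 < T].

Definition solution_on {R : realType} {d : nat}
    (f : 'cV[R]_d -> P2 R d -> 'cV[R]_d) (T : R) (m : R -> P2 R d) : Prop :=
  (forall t : R, t \in `[0, T] ->
     (fun s => W2 (m s) (m t)) @ within [set` `[0, T]] (nbhs t) --> (0 : R)) /\
  (forall phi, test_function T phi ->
     \int[lebesgue_measure]_(t in `[0, T])
       (\int[m t]_x (derive1 (fun s : R => phi (x, s)) t
          + dot (grad (fun y => phi (y, t)) x) (f x (m t)))) = 0).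

(* A solution on [0, +oo); values at negative times are irrelevant. *)
Definition solution {R : realType} {d : nat}
    (f : 'cV[R]_d -> P2 R d -> 'cV[R]_d) (m : R -> P2 R d) : Prop :=
  forall T : R, 0 < T -> solution_on f T m.

Definition equilibrium {R : realType} {d : nat}
    (f : 'cV[R]_d -> P2 R d -> 'cV[R]_d) (mhat : P2 R d) : Prop :=
  solution f (fun=> mhat).

Definition stable {R : realType} {d : nat}
    (f : 'cV[R]_d -> P2 R d -> 'cV[R]_d) (mhat : P2 R d) : Prop :=
  forall eps : R, 0 < eps -> exists2 delta : R, 0 < delta &
    forall (mstar : P2 R d) (t : R) (m : R -> P2 R d),
      W2 mhat mstar < delta -> 0 < t -> solution f m -> m 0 = mstar ->
      W2 mhat (m t) < eps.

Definition lipschitz_field {R : realType} {d : nat}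
    (f : 'cV[R]_d -> P2 R d -> 'cV[R]_d) : Prop :=
  exists C0 : R, forall (x y : 'cV[R]_d) (mu nu : P2 R d),
    enorm (f x mu - f y nu) <= C0 * (enorm (x - y) + W2 mu nu).

(* Main.v *)
Require Import Defs.
From HB Require Import structures.
From mathcomp Require Import all_boot all_order all_algebra.
From mathcomp Require Import all_classical all_reals all_analysis.
From mathcomp Require Import ring lra measurable_realfun.

Set Implicit Arguments.
Unset Strict Implicit.
Unset Printing Implicit Defensive.

Import Order.TTheory GRing.Theory Num.Theory.
Import numFieldNormedType.Exports.

Local Open Scope classical_set_scope.
Local Open Scope ring_scope.

(** The dynamics is affine once the mean is known.  If m solves the equation,
    its mean solves M' = (A + B) M, and m t is the law of
      exp (t A) (x - M 0) + exp (t (A + B)) (M 0)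
    where x has law m 0 ([solution_law]).  Given two solutions and a coupling of
    their initial laws, move both points of the coupling with their flows: their
    difference z becomes exp (t A) (z - zb) + exp (t (A + B)) zb, with zb the
    mean of z.  The centred part and the mean are orthogonal in L_2, so the
    quadratic cost does not increase as soon as both A and A + B are dissipative
    (k . A k <= 0 and k . (A + B) k <= 0 for all k).  Then the Wasserstein
    distance of two solutions never increases ([W2_solutions_le]), and stability
    of the constant solution mhat holds with delta = eps.

    The two dissipativity properties are what the hypothesis on the quadratic
    form says, and two families of tangent fields suffice to see it.  Constant
    fields give A + B ([sum_dissipative]).  The field (k . (x - mean)) k is the
    gradient of a quadratic function and has mean zero; the form equals
    Var (k . x) times k . A k on it ([dissipative_nondegenerate]).  Absolute
    continuity is used here: mhat does not charge the coordinate hyperplanes, so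
    the variance of each coordinate is positive, and a direction with zero
    variance is a limit of directions with positive variance
    ([matrix_dissipative]).  No optimal transport map is involved.

    It remains to compute an arbitrary weak solution, of which only continuity
    for the Wasserstein distance is known.  Let N t = exp (t (A + B)) (M 0) be
    the expected mean and y = exp (- t A) (x - N t) the comoving coordinate.
    Test functions eta (t) psi (y) turn the equation into the statement that the
    average of psi (y) under m t has the weak derivative
      sum_i (average of the i-th partial derivative of psi) (Q w)_i,
    where w is the mean of y under m t, that is, the error made on the mean, and
    Q is a continuous matrix ([weak_moving_average]).  For psi close to a
    coordinate function, this bounds the increments of w by w itself; as w 0 = 0,
    a Gronwall argument gives w = 0 ([comoving_mean_zero]).  Then the average of
    every test function of y is constant in time, and smooth functions with
    compact support determine a measure ([Cc_infty_measure_unique]), so that the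
    law of y is constant in time. *)

(** * Functions of class C^n *)

Lemma class_CS (R : realType) (V : normedModType R) n (f : V -> R) :
  class_C n.+1 f <->
  (forall x, differentiable f x) /\ (forall v, class_C n ('D_v f)).
Proof. by []. Qed.

Lemma class_CW (R : realType) (V : normedModType R) n (f : V -> R) :
  class_C n.+1 f -> class_C n f.
Proof.
elim: n f => [|n IHn] f /= [df Df].
  by move=> x; apply: differentiable_continuous.
by split=> // v; apply: IHn.
Qed.

Section class_C_calculus.
Context {R : realType} {V : normedModType R}.
Implicit Types (f g u : V -> R) (n : nat).

Lemma class_C_ext n f g : f =1 g -> class_C n f -> class_C n g.
Proof. by move=> /funext ->. Qed.

Lemma class_C_cst n (c : R) : class_C n (fun _ : V => c).
Proof.
elim: n c => [|n IHn] c /=; first by move=> x; exact: cvg_cst.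
split=> [x|v]; first exact: differentiable_cst.
have -> : 'D_v (fun _ : V => c) = (fun _ => 0).
  by apply/funext => x; rewrite derive_cst.
exact: IHn.
Qed.

Lemma class_C_continuous n f : class_C n f -> continuous f.
Proof. by elim: n => // n IHn /class_CW. Qed.

Lemma class_C_linear n (f : {linear V -> R}) : continuous f -> class_C n f.
Proof.
case: n => // n fc /=; split=> [x|v]; first exact: linear_differentiable.
have -> : 'D_v f = (fun _ => f v).
  apply/funext => x; rewrite deriveE; last exact: linear_differentiable.
  by rewrite diff_lin.
exact: class_C_cst.
Qed.

Lemma class_CD n f g :
  class_C n f -> class_C n g -> class_C n (fun x => f x + g x).
Proof.
elim: n f g => [|n IHn] f g /=.
  by move=> fc gc x; apply: cvgD; [exact: fc|exact: gc].
move=> [df Df] [dg Dg]; split=> [x|v]; first exact: differentiableD.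
have -> : 'D_v (fun x => f x + g x) = (fun x => 'D_v f x + 'D_v g x).
  by apply/funext => x; rewrite deriveD//; exact: diff_derivable.
exact: IHn.
Qed.

Lemma class_CM n f g :
  class_C n f -> class_C n g -> class_C n (fun x => f x * g x).
Proof.
elim: n f g => [|n IHn] f g.
  by move=> fc gc x; apply: cvgM; [exact: fc|exact: gc].
move=> Cf Cg; have [df Df] := (class_CS _ _).1 Cf.
have [dg Dg] := (class_CS _ _).1 Cg.
split=> [x|v]; first exact: differentiableM.
have -> : 'D_v (fun x => f x * g x) = (fun x => f x * 'D_v g x + g x * 'D_v f x).
  apply/funext => x.
  by rewrite (deriveM (diff_derivable (df x)) (diff_derivable (dg x))).
by apply: class_CD; apply: IHn => //; exact: class_CW.
Qed.

Lemma class_CN n f : class_C n f -> class_C n (fun x => - f x).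
Proof.
move=> Cf; apply: (@class_C_ext _ (fun x => -1 * f x)).
  by move=> x; rewrite mulN1r.
apply: class_CM; last by [].
exact: class_C_cst.
Qed.

Lemma class_CB n f g :
  class_C n f -> class_C n g -> class_C n (fun x => f x - g x).
Proof. by move=> Cf Cg; apply: class_CD => //; exact: class_CN. Qed.

Lemma class_C_sum n (I : Type) (r : seq I) (F : I -> V -> R) :
  (forall i, class_C n (F i)) -> class_C n (fun x => \sum_(i <- r) F i x).
Proof.
move=> CF; elim: r => [|i r IHr].
  by apply: (@class_C_ext _ (fun=> 0)) => [x|]; [rewrite big_nil|exact: class_C_cst].
apply: (@class_C_ext _ (fun x => F i x + \sum_(j <- r) F j x)).
  by move=> x; rewrite big_cons.
exact: class_CD.
Qed.

Lemma class_C_prod n (I : Type) (r : seq I) (F : I -> V -> R) :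
  (forall i, class_C n (F i)) -> class_C n (fun x => \prod_(i <- r) F i x).
Proof.
move=> CF; elim: r => [|i r IHr].
  by apply: (@class_C_ext _ (fun=> 1)) => [x|]; [rewrite big_nil|exact: class_C_cst].
apply: (@class_C_ext _ (fun x => F i x * \prod_(j <- r) F j x)).
  by move=> x; rewrite big_cons.
exact: class_CM.
Qed.

Lemma class_CV n f : (forall x, f x != 0) -> class_C n f ->
  class_C n (fun x => (f x)^-1).
Proof.
move=> f0; elim: n => [|n IHn].
  by move=> fc x; apply: cvgV => //; exact: fc.
move=> Cf; have [df Df] := (class_CS _ _).1 Cf.
split=> [x|v]; first exact: differentiableV.
have -> : 'D_v (fun x => (f x)^-1) =
    (fun x => - ((f x)^-1 * (f x)^-1 * 'D_v f x)).
  apply/funext => x; rewrite (deriveV (f0 x) (diff_derivable (df x))).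
  by rewrite /GRing.scale/= mulNr -expr2 -exprVn.
by apply: class_CN; apply: class_CM => //; apply: class_CM; apply: IHn;
  exact: class_CW.
Qed.

Lemma class_C_comp_real n (b : R -> R) u :
  class_C n b -> class_C n u -> class_C n (b \o u).
Proof.
elim: n b u => [|n IHn] b u.
  by move=> bc uc x; apply: continuous_comp; [exact: uc|exact: bc].
move=> Cb Cu; have [db Db] := (class_CS _ _).1 Cb.
have [du Du] := (class_CS _ _).1 Cu.
split=> [x|v]; first exact: differentiable_comp.
have -> : 'D_v (b \o u) = (fun x => ('D_1 b \o u) x * 'D_v u x).
  apply/funext => x; rewrite deriveE; last exact: differentiable_comp.
  rewrite diff_comp//= (deriveE _ (du x)) (deriveE _ (db _)) mulrC.
  by rewrite -[X in 'd b (u x) X]mulr1 -[X in X = _]/(_ (_ *: _)) linearZ.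
by apply: class_CM => //; apply: IHn => //; exact: class_CW.
Qed.

Lemma cV_sum_delta d (x : 'cV[R]_d) :
  x = \sum_i x i ord0 *: delta_mx i (ord0 : 'I_1).
Proof. by rewrite {1}(matrix_sum_delta x); under eq_bigr do rewrite big_ord1. Qed.

Lemma differentiable_cV d (y : V -> 'cV[R]_d) x :
  (forall i, differentiable (fun z => y z i ord0) x) -> differentiable y x.
Proof.
move=> dy.
have -> : y = \sum_i (fun z => y z i ord0 *: delta_mx i (ord0 : 'I_1)).
  by apply/funext => z; rewrite fct_sumE {1}(cV_sum_delta (y z)).
by apply: differentiable_sum => i; exact: differentiableZl.
Qed.

Lemma continuous_cV d (y : V -> 'cV[R]_d) x :
  (forall i, {for x, continuous (fun z => y z i ord0)}) ->
  {for x, continuous y}.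
Proof.
move=> cy.
have -> : y = \sum_i (fun z => y z i ord0 *: delta_mx i (ord0 : 'I_1)).
  by apply/funext => z; rewrite fct_sumE {1}(cV_sum_delta (y z)).
apply: (big_ind (fun f : V -> 'cV[R]_d => {for x, continuous f})).
- exact: cvg_cst.
- by move=> f g cf cg; exact: cvgD.
- by move=> i _; exact: cvgZr_tmp (cy i).
Qed.

(** The differential of psi is linear, so it suffices to split the velocity of y
    along the canonical basis. *)
Lemma derive_comp_cV d (psi : 'cV[R]_d -> R) (y : V -> 'cV[R]_d) x v :
  differentiable psi (y x) ->
  (forall i, differentiable (fun z => y z i ord0) x) ->
  'D_v (psi \o y) x = \sum_i 'D_(delta_mx i ord0) psi (y x)
                             * 'D_v (fun z => y z i ord0) x.
Proof.
move=> dpsi dy.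
have dY : differentiable y x by exact: differentiable_cV.
rewrite deriveE; last exact: differentiable_comp.
rewrite diff_comp//= -(deriveE _ dY) derive_mx; last exact: diff_derivable.
set w := (X in 'd psi _ X); rewrite [w]cV_sum_delta linear_sum/=.
by apply: eq_bigr => i _; rewrite linearZ/= -deriveE// mxE mulrC.
Qed.

(** The partial derivatives of psi get composed with the same y, which lets the
    induction on n go through; y enters by its coordinates only, as C^n is a
    notion for scalar functions. *)
Lemma class_C_comp n d (psi : 'cV[R]_d -> R) (y : V -> 'cV[R]_d) :
  class_C n psi -> (forall i, class_C n (fun z => y z i ord0)) ->
  class_C n (psi \o y).
Proof.
elim: n psi => [|n IHn] psi.
  move=> psic yc x; apply: continuous_comp; last exact: psic.
  by apply: continuous_cV => i; exact: yc.
move=> /class_CS[dpsi Dpsi] Cy.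
have dy x i : differentiable (fun z => y z i ord0) x by have [] := Cy i.
split=> [x|v].
  by apply: differentiable_comp => //; apply: differentiable_cV.
have -> : 'D_v (psi \o y) = (fun x => \sum_i
    ('D_(delta_mx i ord0) psi \o y) x * 'D_v (fun z => y z i ord0) x).
  by apply/funext => x; rewrite derive_comp_cV.
apply: class_C_sum => i; apply: class_CM; last by case/class_CS: (Cy i) => _; apply.
by apply: IHn => // j; exact: class_CW.
Qed.

End class_C_calculus.

(** * A smooth step function *)

Section smooth_step.
Context {R : realType}.
Implicit Types (p : {poly R}) (x u : R).

(** exp (- 1 / x) times a polynomial in 1 / x.  Since (1 / x)' = - (1 / x) ^ 2,
    derivation maps this family to itself: smoothness becomes an induction over
    the whole family instead of a computation of iterated derivatives. *)
Definition flat p x : R := if 0 < x then p.[x^-1] * expR (- x^-1) else 0.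

(** The power series of exp gives u ^ i <= i! exp u for each monomial. *)
Lemma poly_expRN_bounded p :
  exists2 C : R, 0 <= C & forall u, 0 <= u -> `|p.[u]| * expR (- u) <= C.
Proof.
exists (\sum_(i < size p) `|p`_i| * i`!%:R).
  by apply: sumr_ge0 => i _; rewrite mulr_ge0.
move=> u u0; rewrite horner_coef.
apply: (@le_trans _ _ ((\sum_(i < size p) `|p`_i * u ^+ i|) * expR (- u))).
  by rewrite ler_wpM2r ?expR_ge0//; exact: ler_norm_sum.
rewrite mulr_suml; apply: ler_sum => i _.
rewrite normrM -mulrA ler_wpM2l// normrX ger0_norm// expRN.
rewrite ler_pdivrMr ?expR_gt0//.
case: (nat_of_ord i) => [|k].
  by rewrite expr0 fact0 mul1r -expR0 ler_expR.
have := expR_ge1Dxn k u0; rewrite -ler_pdivrMl ?ltr0n ?fact_gt0// mulrC.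
by apply: le_trans; rewrite lerDr.
Qed.

(** The exponential absorbs any power of 1 / x, here two more than p contains.
    Second order vanishing at 0 gives continuity and differentiability there. *)
Lemma flat_le_sqr p : exists2 C : R, 0 <= C & forall x, `|flat p x| <= C * x ^+ 2.
Proof.
have [C C0 HC] := poly_expRN_bounded (p * 'X^2).
exists C => // x; rewrite /flat; case: ltP => x0; last first.
  by rewrite normr0 mulr_ge0// sqr_ge0.
have xV0 : 0 <= x^-1 by rewrite invr_ge0 ltW.
have := HC _ xV0; rewrite hornerM hornerXn -ler_pdivrMr ?exprn_gt0//.
apply: le_trans; rewrite normrM (ger0_norm (expR_ge0 _)) normrM.
rewrite (ger0_norm (exprn_ge0 _ _))//.
by rewrite exprVn mulrAC.
Qed.

Lemma is_derive_flat p x :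
  is_derive x (1 : R) (flat p) (flat ((p - p^`()) * 'X^2) x).
Proof.
have [x0|x0|->] := ltgtP x 0.
- apply: (@near_eq_is_derive _ _ _ (cst 0)) => //.
  + near=> z; rewrite /flat ifF//; apply/negbTE; rewrite -leNgt ltW//.
    by near: z; exact: lt_nbhsl.
  + by rewrite /flat ifF; [exact: is_derive_cst|rewrite ltNge ltW].
- have xN0 : x != 0 by rewrite gt_eqF.
  apply: (@near_eq_is_derive R R R
    (fun z : R => p.[z^-1] * expR (- z^-1))) => //.
  + near=> z; rewrite /flat ifT//.
    by near: z; exact: lt_nbhsr.
  + rewrite /flat x0.
    have dV : is_derive x 1 (fun z : R => z^-1) (- (x^-1 * x^-1)).
      apply: (is_derive_eq (@is_deriveV R id x 1 1 xN0 (is_derive_id _ _))).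
      by rewrite /GRing.scale/= mulr1 expr2 invfM.
    have dp := is_derive1_comp (is_derive_poly p x^-1) dV.
    have dN := is_deriveN dV.
    have de := @is_derive1_comp R expR (fun z => - z^-1) x _ _
      (is_derive_expR (- x^-1)) dN.
    apply: (is_derive_eq (is_deriveM dp de)).
    rewrite /GRing.scale/= hornerM hornerXn hornerD hornerN; ring.
- rewrite {2}/flat ltxx.
  have [C C0 HC] := flat_le_sqr p.
  have f0 : flat p 0 = 0 by rewrite /flat ltxx.
  have lim0 : h^-1 *: ((flat p \o shift 0) (h *: 1) - flat p 0) @[h --> 0^'] --> (0 : R).
    apply/cvgrPdist_le => e e0; near=> h.
    rewrite /= f0 subr0 addr0 sub0r normrN [h *: 1]mulr1 normrM normfV.
    have h0 : h != 0 by near: h; exact: nbhs_dnbhs_neq.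
    rewrite mulrC ler_pdivrMr ?normr_gt0//.
    apply: le_trans (HC h) _; rewrite -real_normK ?num_real// expr2 mulrA.
    rewrite ler_wpM2r//.
    have he : `|h| <= e / (C + 1).
      by near: h; apply: dnbhs0_le; rewrite divr_gt0// ltr_wpDl.
    apply: (le_trans (ler_wpM2l C0 he)).
    rewrite mulrCA; apply: ler_piMr; first exact: ltW.
    by rewrite ler_pdivrMr ?ltr_wpDl// mul1r lerDl.
  by apply: DeriveDef; [apply/cvg_ex; exists 0; exact: lim0|exact: cvg_lim lim0].
Unshelve. all: by end_near. Qed.

Lemma derive_real (f : R -> R) x v : derivable f x 1 -> 'D_v f x = v * 'D_1 f x.
Proof.
move=> /derivable1_diffP df; rewrite !deriveE//.
by rewrite -[in LHS](mulr1 v) -[v * 1]/(v *: (1 : R)) linearZ.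
Qed.

Lemma class_C_real_derive n (f : R -> R) (df : R -> R) :
  (forall x, is_derive x (1 : R) f (df x)) -> class_C n df -> class_C n.+1 f.
Proof.
move=> fdf Cdf; apply/class_CS; split=> [x|v].
  by apply/derivable1_diffP; have [] := fdf x.
apply: (@class_C_ext _ _ _ (fun x => v * df x)).
  by move=> x; case: (fdf x) => dx <-; rewrite (derive_real v dx).
by apply: class_CM => //; exact: class_C_cst.
Qed.

Lemma class_C_flat n p : class_C n (flat p).
Proof.
elim: n p => [|n IHn] p; last exact: class_C_real_derive (is_derive_flat p) (IHn _).
move=> x; apply: differentiable_continuous; apply/derivable1_diffP.
by have [] := is_derive_flat p x.
Qed.

Definition step x : R := flat 1 x / (flat 1 x + flat 1 (1 - x)).

Lemma flat1_ge0 x : 0 <= flat 1 x.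
Proof. by rewrite /flat; case: ifP => // _; rewrite hornerC mul1r expR_ge0. Qed.

Lemma flat1_gt0 x : 0 < x -> 0 < flat 1 x.
Proof. by rewrite /flat => ->; rewrite hornerC mul1r expR_gt0. Qed.

Lemma flat_le0 p x : x <= 0 -> flat p x = 0.
Proof. by move=> x0; rewrite /flat ltNge x0. Qed.

Lemma step_den_gt0 x : 0 < flat 1 x + flat 1 (1 - x).
Proof.
have [x0|x0] := ltP 0 x; first by rewrite ltr_wpDr ?flat1_ge0 ?flat1_gt0.
by rewrite ltr_wpDl ?flat1_ge0// flat1_gt0// subr_gt0 (le_lt_trans x0).
Qed.

Lemma class_C_step n : class_C n step.
Proof.
apply: class_CM; first exact: class_C_flat.
apply: class_CV => [x|]; first by rewrite gt_eqF ?step_den_gt0.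
apply: class_CD; first exact: class_C_flat.
apply: (@class_C_comp_real _ _ _ (flat 1) (fun x => 1 - x)).
  exact: class_C_flat.
apply: class_CB; first exact: class_C_cst.
by apply: (@class_C_linear _ _ _ idfun) => x; exact: cvg_id.
Qed.

Lemma step_le0 x : x <= 0 -> step x = 0.
Proof. by move=> x0; rewrite /step flat_le0// mul0r. Qed.

Lemma step_ge1 x : 1 <= x -> step x = 1.
Proof.
move=> x1; rewrite /step [flat 1 (1 - x)]flat_le0 ?subr_le0// addr0.
by rewrite divff// gt_eqF// flat1_gt0// (lt_le_trans ltr01).
Qed.

Lemma step_ge0 x : 0 <= step x.
Proof. by rewrite divr_ge0 ?flat1_ge0// ltW// step_den_gt0. Qed.

Lemma step_le1 x : step x <= 1.
Proof. by rewrite ler_pdivrMr ?step_den_gt0// mul1r lerDl flat1_ge0. Qed.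

End smooth_step.

(** * The Euclidean product and the matrix exponential *)

Section dot_product.
Context {R : realType} {d : nat}.
Implicit Types u v w : 'cV[R]_d.

Lemma dotE u v : dot u v = \sum_i u i ord0 * v i ord0.
Proof. by rewrite /dot mxE; apply: eq_bigr => i _; rewrite mxE. Qed.

Lemma dotC u v : dot u v = dot v u.
Proof. by rewrite !dotE; apply: eq_bigr => i _; rewrite mulrC. Qed.

Lemma dotDl u v w : dot (u + v) w = dot u w + dot v w.
Proof. by rewrite /dot linearD mulmxDl mxE. Qed.

Lemma dotDr u v w : dot u (v + w) = dot u v + dot u w.
Proof. by rewrite /dot mulmxDr mxE. Qed.

Lemma dotZl (a : R) u v : dot (a *: u) v = a * dot u v.
Proof. by rewrite /dot linearZ -scalemxAl mxE. Qed.

Lemma dotZr (a : R) u v : dot u (a *: v) = a * dot u v.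
Proof. by rewrite dotC dotZl dotC. Qed.

Lemma dotNl u v : dot (- u) v = - dot u v.
Proof. by rewrite -scaleN1r dotZl mulN1r. Qed.

Lemma dotNr u v : dot u (- v) = - dot u v.
Proof. by rewrite dotC dotNl dotC. Qed.

Lemma dotr0 u : dot u 0 = 0.
Proof. by rewrite -(scale0r (0 : 'cV[R]_d)) dotZr mul0r. Qed.

Lemma dot_ge0 u : 0 <= dot u u.
Proof. by rewrite dotE; apply: sumr_ge0 => i _; rewrite -expr2 sqr_ge0. Qed.

Lemma enorm_ge0 u : 0 <= enorm u.
Proof. exact: sqrtr_ge0. Qed.

Lemma sqr_enorm u : enorm u ^+ 2 = dot u u.
Proof. by rewrite sqr_sqrtr// dot_ge0. Qed.

Lemma coord_le_enorm u i : `|u i ord0| <= enorm u.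
Proof.
rewrite -(sqrtr_sqr (u i ord0)); apply: ler_wsqrtr.
rewrite dotE (bigD1 i)//= -expr2 lerDl.
by apply: sumr_ge0 => j _; rewrite -expr2 sqr_ge0.
Qed.

End dot_product.

Section matrix_exponential.
Context {R : realType} {d : nat}.
Implicit Types (A M : 'M[R]_d) (t : R).

(** Coefficients of the power series of exp (t A) M.  The factor M keeps the
    family closed under derivation, which replaces M by A M. *)
Definition mexp_coeff A M i j : R^nat := fun n => (A ^+ n *m M) i j / n`!%:R.

Definition mexp A t : 'M[R]_d :=
  \matrix_(i, j) limn (pseries (mexp_coeff A 1%:M i j) t).

Lemma mexp_coeff_diffs A M i j :
  pseries_diffs (mexp_coeff A M i j) = mexp_coeff A (A *m M) i j.
Proof.
apply/funext => n; rewrite /pseries_diffs /mexp_coeff mulmxA exprSr factS natrM.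
by rewrite invfM mulrCA (mulrA n.+1%:R) divff ?mul1r// pnatr_eq0.
Qed.

Lemma exprmx_entry_le A n i j :
  `|(A ^+ n) i j| <= (\sum_k \sum_l `|A k l|) ^+ n.
Proof.
set K := \sum_k _.
have K0 : 0 <= K by apply: sumr_ge0 => k _; exact: sumr_ge0.
elim: n i j => [|n IHn] i j.
  by rewrite expr0 expr0 mxE; case: eqP => _; rewrite ?normr1 ?normr0.
rewrite exprS [A * _]/(A *m _) mxE exprS.
apply: le_trans (ler_norm_sum _ _ _) _.
have -> : K * K ^+ n = \sum_k (\sum_l `|A k l|) * K ^+ n by rewrite mulr_suml.
rewrite [leRHS](bigD1 i)//= -[leLHS]addr0; apply: lerD.
  rewrite mulr_suml; apply: ler_sum => k _; rewrite normrM.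
  by rewrite ler_wpM2l.
by apply: sumr_ge0 => k _; rewrite mulr_ge0 ?exprn_ge0//; exact: sumr_ge0.
Qed.

Lemma is_cvg_mexp1 A i j t : cvgn (pseries (mexp_coeff A 1%:M i j) t).
Proof.
set K := \sum_k \sum_l `|A k l|.
have K0 : 0 <= K by apply: sumr_ge0 => k _; exact: sumr_ge0.
apply: normed_cvg.
apply: (@series_le_cvg _ _ (exp_coeff (K * `|t|))) => [n|n|n|].
- exact: normr_ge0.
- by rewrite exp_coeff_ge0// mulr_ge0.
- rewrite /exp_coeff/= /mexp_coeff mulmx1 !normrM normfV normr_nat normrX.
  rewrite exprMn mulrAC ler_wpM2r// ?invr_ge0// ler_wpM2r//.
  exact: exprmx_entry_le.
- exact: is_cvg_series_exp_coeff.
Qed.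

Lemma cvg_mexp A M i j t :
  pseries (mexp_coeff A M i j) t @ \oo --> (mexp A t *m M) i j.
Proof.
rewrite mxE.
have -> : pseries (mexp_coeff A M i j) t =
    \sum_k (fun n => pseries (mexp_coeff A 1%:M i k) t n * M k j).
  apply/funext => n; rewrite fct_sumE /pseries /series/=.
  under [RHS]eq_bigr do rewrite mulr_suml.
  rewrite exchange_big/=; apply: eq_bigr => m _.
  rewrite /mexp_coeff mulmx1 mxE !mulr_suml; apply: eq_bigr => k _.
  by rewrite -!mulrA; congr (_ * _); rewrite mulrC mulrA.
elim/big_ind2 : _ => [|f a g b fa gb|k _]; first exact: cvg_cst.
  exact: cvgD.
apply: cvgM; last exact: cvg_cst.
by rewrite mxE; exact: is_cvg_mexp1.
Qed.

Lemma is_cvg_mexp A M i j t : cvgn (pseries (mexp_coeff A M i j) t).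
Proof. by apply/cvg_ex; eexists; exact: cvg_mexp. Qed.

(** Both sides are the sum of A ^ n.+1 t ^ n / n!. *)
Lemma mexp_comm A t : mexp A t *m A = A *m mexp A t.
Proof.
apply/matrixP => i j.
suff : pseries (mexp_coeff A A i j) t @ \oo --> (A *m mexp A t) i j.
  by apply: (cvg_unique _ (@cvg_mexp A A i j t)).
have -> : pseries (mexp_coeff A A i j) t =
    \sum_k (fun n => A i k * pseries (mexp_coeff A 1%:M k j) t n).
  apply/funext => n; rewrite fct_sumE /pseries /series/=.
  under [RHS]eq_bigr do rewrite mulr_sumr.
  rewrite exchange_big/=; apply: eq_bigr => m _.
  rewrite /mexp_coeff -[_ *m A]/(_ * A) -exprSr exprS [A * _]/(A *m _) mulmx1.
  by rewrite mxE !mulr_suml; apply: eq_bigr => k _; rewrite !mulrA.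
rewrite mxE.
elim/big_ind2 : _ => [|f a g b fa gb|k _]; first exact: cvg_cst.
  exact: cvgD.
apply: cvgM; first exact: cvg_cst.
by rewrite mxE; exact: is_cvg_mexp1.
Qed.

Lemma is_derive_mexpr A i j t :
  is_derive t (1 : R) (fun s => mexp A s i j) ((mexp A t *m A) i j).
Proof.
have -> : (fun s => mexp A s i j) =
    (fun s => limn (pseries (mexp_coeff A 1%:M i j) s)).
  by apply/funext => s; rewrite mxE.
rewrite -(cvg_lim _ (@cvg_mexp A A i j t))//.
have -> : mexp_coeff A A i j = pseries_diffs (mexp_coeff A 1%:M i j).
  by rewrite mexp_coeff_diffs mulmx1.
apply: (@pseries_snd_diffs _ _ (`|t| + 1)); rewrite ?mexp_coeff_diffs.
- exact: is_cvg_mexp.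
- exact: is_cvg_mexp.
- exact: is_cvg_mexp.
- by rewrite [ltRHS]ger0_norm ?addr_ge0// ltrDl.
Qed.

Lemma is_derive_mexpl A i j t :
  is_derive t (1 : R) (fun s => mexp A s i j) ((A *m mexp A t) i j).
Proof. by rewrite -mexp_comm; exact: is_derive_mexpr. Qed.

Lemma mexp0 A : mexp A 0 = 1%:M.
Proof.
apply/matrixP => i j; rewrite mxE.
apply: lim_near_cst => //; near=> n.
rewrite /pseries /series/= -[n]prednK; last by near: n; exact: nbhs_infty_gt.
rewrite big_nat_recl// big1 => [|k _]; last by rewrite exprS mul0r mulr0.
by rewrite addr0 /mexp_coeff mulmx1 expr0 fact0 divr1 mulr1.
Unshelve. all: by end_near. Qed.

Lemma class_C_mexp n A i j : class_C n (fun t => mexp A t i j).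
Proof.
elim: n i j => [|n IHn] i j.
  move=> x; apply: differentiable_continuous; apply/derivable1_diffP.
  by have [] := is_derive_mexpr A i j x.
apply: class_C_real_derive (is_derive_mexpr A i j) _.
apply: (@class_C_ext _ _ _ (fun t => \sum_k mexp A t i k * A k j)).
  by move=> t; rewrite mxE.
by apply: class_C_sum => k; apply: class_CM => //; exact: class_C_cst.
Qed.

Lemma is_derive_sumfun n (h : 'I_n -> R -> R) (dh : 'I_n -> R) x :
  (forall i, is_derive x (1 : R) (h i) (dh i)) ->
  is_derive x (1 : R) (fun t => \sum_i h i t) (\sum_i dh i).
Proof.
move=> H; have := is_derive_sum H.
by congr (is_derive _ _ _ _); apply/funext => t; rewrite fct_sumE.
Qed.

(** The derivative of exp (- s A) exp (s A) is exp (- s A) (- A + A) exp (s A). *)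
Lemma mexpNK A t : mexp (- A) t *m mexp A t = 1%:M.
Proof.
apply/matrixP => i j.
have -> : (1%:M : 'M[R]_d) i j = (mexp (- A) 0 *m mexp A 0) i j.
  by rewrite !mexp0 mulmx1.
apply: (@is_derive_0_is_cst _ (fun s => (mexp (- A) s *m mexp A s) i j)) => s.
have -> : (fun s => (mexp (- A) s *m mexp A s) i j) =
    (fun s => \sum_k mexp (- A) s i k * mexp A s k j).
  by apply/funext => u; rewrite mxE.
apply: is_derive_eq.
  apply: is_derive_sumfun => k.
  exact: (is_deriveM (is_derive_mexpr (- A) i k s) (is_derive_mexpl A k j s)).
rewrite big_split/=.
transitivity ((mexp (- A) s *m (A *m mexp A s)
    + (mexp (- A) s *m (- A)) *m mexp A s) i j).
  rewrite !mxE; congr (_ + _); apply: eq_bigr => k _ //.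
  by rewrite /GRing.scale/= mulrC.
by rewrite mulmxN mulNmx mulmxA subrr mxE.
Qed.

Lemma mexpKN A t : mexp A t *m mexp (- A) t = 1%:M.
Proof. exact: mulmx1C (mexpNK A t). Qed.

(** With v = exp (s A) u, the derivative of the square of the norm of v is
    2 v . A v. *)
Lemma mexp_contraction A t (u : 'cV[R]_d) :
  (forall k : 'cV[R]_d, dot k (A *m k) <= 0) -> 0 <= t ->
  dot (mexp A t *m u) (mexp A t *m u) <= dot u u.
Proof.
move=> A_le0 t0.
pose h s := dot (mexp A s *m u) (mexp A s *m u).
have dE s i : is_derive s (1 : R) (fun s => (mexp A s *m u) i ord0)
    ((A *m (mexp A s *m u)) i ord0).
  have -> : (fun s => (mexp A s *m u) i ord0) =
      (fun s => \sum_k mexp A s i k * u k ord0).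
    by apply/funext => r; rewrite mxE.
  apply: is_derive_eq.
    apply: is_derive_sumfun => k.
    exact: (is_deriveM (is_derive_mexpl A i k s) (is_derive_cst (u k ord0) s 1)).
  rewrite mulmxA [RHS]mxE; apply: eq_bigr => k _.
  by rewrite scaler0 add0r /GRing.scale/= mulrC.
have dh s : is_derive s (1 : R) h
    (2 * dot (mexp A s *m u) (A *m (mexp A s *m u))).
  have -> : h = (fun s => \sum_i (mexp A s *m u) i ord0 * (mexp A s *m u) i ord0).
    by apply/funext => r; rewrite /h dotE.
  apply: is_derive_eq.
    by apply: is_derive_sumfun => i; exact: (is_deriveM (dE s i) (dE s i)).
  rewrite dotE mulr_sumr; apply: eq_bigr => i _.
  by rewrite /GRing.scale/= -mulr2n mulr_natl.
have -> : dot u u = h 0 by rewrite /h mexp0 mul1mx.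
apply: (@ler0_derive1_nincry _ h 0) => //.
- move=> s _; rewrite derive1E; have [_ ->] := dh s.
  by rewrite pmulr_rle0 ?ltr0n//; exact: A_le0.
- apply: continuous_subspaceT => s; apply: differentiable_continuous.
  by apply/derivable1_diffP; have [] := dh s.
Qed.

End matrix_exponential.

(** * Borel sets and bump functions *)

Section borel_cV.
Context {R : realType} {d : nat}.
Implicit Types (a b x : 'cV[R]_d).

Lemma open_measurable_cV (U : set 'cV[R]_d) : open U -> measurable U.
Proof. by move=> oU; apply: sub_sigma_algebra. Qed.

Lemma continuous_measurable_cV (h : 'cV[R]_d -> R) :
  continuous h -> measurable_fun setT h.
Proof.
move=> /continuousP ch; apply: (measurability _ (RGenOpens.measurableE R)).
move=> _ [_ [a [b ->] <-]]; rewrite setTI; apply: open_measurable_cV.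
exact/ch/interval_open.
Qed.

Lemma continuous_measurable_cVcV (h : 'cV[R]_d -> 'cV[R]_d) :
  continuous h -> measurable_fun setT h.
Proof.
move=> /continuousP ch.
apply: (@measurability _ _ _ _ _ _ (@open 'cV[R]_d)) => //.
by move=> _ [U oU <-]; rewrite setTI; apply: open_measurable_cV; exact: ch.
Qed.

Lemma coord_cV_continuous i : continuous (fun x : 'cV[R]_d => x i ord0).
Proof. exact: coord_continuous. Qed.

Lemma measurable_coord i : measurable_fun setT (fun x : 'cV[R]_d => x i ord0).
Proof. by apply: continuous_measurable_cV; exact: coord_cV_continuous. Qed.

Definition open_box a b : set 'cV[R]_d :=
  [set x | forall i, a i ord0 < x i ord0 < b i ord0].

Lemma open_open_box a b : open (open_box a b).
Proof.
rewrite openE => x abx; rewrite /interior/=.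
have H (i : 'I_d) : nbhs x [set y : 'cV[R]_d | a i ord0 < y i ord0 < b i ord0].
  case/andP: (abx i) => ax xb.
  apply: (filterS (P := (fun y : 'cV[R]_d => y i ord0) @^-1` [set r | a i ord0 < r]
     `&` (fun y : 'cV[R]_d => y i ord0) @^-1` [set r | r < b i ord0])).
    by move=> y [/= -> ->].
  apply: filterI; apply: (coord_cV_continuous (x := x)); first exact: lt_nbhsr.
  exact: lt_nbhsl.
exact: (filter_forall _ H).
Qed.

Definition open_boxes : set (set 'cV[R]_d) :=
  [set X | exists a b, X = open_box a b].

Lemma open_boxes_setI : setI_closed open_boxes.
Proof.
move=> _ _ [a [b ->]] [a' [b' ->]].
exists (\col_i Num.max (a i ord0) (a' i ord0)).
exists (\col_i Num.min (b i ord0) (b' i ord0)).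
apply/seteqP; split=> [x [abx abx'] i|x H].
  rewrite !mxE gt_max lt_min; have /andP[-> ->] := abx i.
  by have /andP[-> ->] := abx' i.
by split=> i; have := H i; rewrite !mxE gt_max lt_min
   => /andP[/andP[? ?] /andP[? ?]]; apply/andP.
Qed.

Definition rat_box (qn : 'cV[rat]_d * nat) : set 'cV[R]_d :=
  open_box (\col_i (ratr (qn.1 i ord0) - qn.2.+1%:R^-1))
           (\col_i (ratr (qn.1 i ord0) + qn.2.+1%:R^-1)).

(** Boxes with rational centre and half-width 1 / n.+1 are countably many and
    arbitrarily small. *)
Lemma open_bigcup_rat_box (U : set 'cV[R]_d) : open U ->
  U = \bigcup_(qn in [set qn | rat_box qn `<=` U]) rat_box qn.
Proof.
move=> oU; apply/seteqP; split=> [x Ux|x [qn qnU]]; last exact: qnU.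
have /nbhs_ballP[e /= e0 eU] : nbhs x U by exact: open_nbhs_nbhs.
near \oo => n.
have n0 : 0 < n.+1%:R^-1 :> R by rewrite invr_gt0.
have ne : n.+1%:R^-1 < e / 2.
  by near: n; exact: (near_infty_natSinv_lt (PosNum (divr_gt0 e0 (ltr0n _ 2)))).
have [q qE] : exists q : 'cV[rat]_d,
    forall i, x i ord0 < ratr (q i ord0) < x i ord0 + n.+1%:R^-1.
  exists (\col_i
    projT1 (cid (rat_in_itvoo (ltr_pwDr n0 (lexx (x i ord0)))))) => i.
  by rewrite mxE; case: cid => r /=; rewrite in_itv.
exists (q, n) => /=; last first.
  move=> i; rewrite !mxE/=; have /andP[xq qx] := qE i.
  by rewrite ltrBlDr qx/= (lt_trans xq)// ltrDl.
move=> y yq; apply: eU; split=> // i j; rewrite ord1.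
have := yq i; rewrite !mxE/= => /andP[y1 y2]; have /andP[xq qx] := qE i.
move: y1 y2 xq qx ne; rewrite /ball/= ltr_norml.
move: (ratr _) (n.+1%:R^-1) => Q r y1 y2 xq qx ne.
by apply/andP; split; lra.
Unshelve. all: by end_near. Qed.

Lemma measurable_cV_boxes : @measurable _ 'cV[R]_d = <<s open_boxes >>.
Proof.
apply/seteqP; split; apply: smallest_sub.
- exact: smallest_sigma_algebra.
- move=> U /open_bigcup_rat_box ->.
  rewrite bigcup_mkcond.
  apply: (@countable_bigcupT_measurable _ (g_sigma_algebraType open_boxes)).
    exact: countableP.
  move=> qn; case: ifPn => _; last exact: measurable0.
  by apply: sub_sigma_algebra; do 2!eexists; reflexivity.
- exact: smallest_sigma_algebra.
- by move=> _ [a [b ->]]; apply: open_measurable_cV; exact: open_open_box.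
Qed.

Lemma compact_box a b : compact (box a b).
Proof.
have -> : box a b = trmx @` [set v : 'rV[R]_d |
    forall i, `[a i ord0, b i ord0]%classic (v ord0 i)].
  apply/seteqP; split=> [x abx|_ [v abv <-] i].
    exists x^T; last by rewrite trmxK.
    by move=> i; rewrite /= in_itv/= mxE; exact: abx.
  by have := abv i; rewrite /= in_itv/= mxE.
apply: continuous_compact; last first.
  apply: (@rV_compact R _ (fun i => `[a i ord0, b i ord0]%classic)) => i.
  exact: segment_compact.
apply: continuous_subspaceT => x; apply: continuous_cV => i.
have -> : (fun z : 'rV[R]_d => z^T i ord0) = (fun z => z ord0 i).
  by apply/funext => z; rewrite mxE.
exact: coord_continuous.
Qed.

(** A compact set is closed, hence contains the closure of any of its subsets. *)
Lemma Cc_infty_compact (V : normedModType R) (K : set V) (psi : V -> R) :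
  compact K -> (forall z, psi z != 0 -> K z) ->
  (forall n, class_C n psi) -> Cc_infty psi.
Proof.
move=> cK psiK Cpsi; split=> //.
have clK : closed K by apply: compact_closed => //; exact: norm_hausdorff.
apply: (subclosed_compact _ cK); first exact: closed_closure.
rewrite /support_closure; rewrite [X in _ `<=` X](closure_id K).1//.
by apply: closure_subset => z; exact: psiK.
Qed.

Lemma class_C_coord n i : class_C n (fun x : 'cV[R]_d => x i ord0).
Proof.
have @f : {linear 'cV[R]_d -> R}.
  by exists (fun N : 'cV[R]_d => N i ord0); do 2![eexists]; do ?[constructor];
     rewrite ?mxE// => ? *; rewrite ?mxE//; move=> ?; rewrite !mxE.
suff : class_C n f by [].
by apply: class_C_linear => x; exact: coord_continuous.
Qed.

(** A smooth approximation of the indicator of the open box from inside. *)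
Definition box_bump (k : nat) a b x : R :=
  \prod_i (step (k%:R * (x i ord0 - a i ord0))
         * step (k%:R * (b i ord0 - x i ord0))).

Lemma class_C_box_bump n k a b : class_C n (box_bump k a b).
Proof.
apply: class_C_prod => i; apply: class_CM.
- apply: (@class_C_comp_real _ _ _ step (fun x => k%:R * (x i ord0 - a i ord0))).
    exact: class_C_step.
  apply: class_CM; first exact: class_C_cst.
  by apply: class_CB; [exact: class_C_coord|exact: class_C_cst].
- apply: (@class_C_comp_real _ _ _ step (fun x => k%:R * (b i ord0 - x i ord0))).
    exact: class_C_step.
  apply: class_CM; first exact: class_C_cst.
  by apply: class_CB; [exact: class_C_cst|exact: class_C_coord].
Qed.

Lemma box_bump_out k a b x : ~ open_box a b x -> box_bump k a b x = 0.
Proof.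
move=> /existsNP[i /negP abx]; rewrite /box_bump (bigD1 i)//=.
suff -> : step (k%:R * (x i ord0 - a i ord0))
   * step (k%:R * (b i ord0 - x i ord0)) = 0 by rewrite mul0r.
move: abx; rewrite negb_and -!leNgt => /orP[xa|bx].
  by rewrite step_le0 ?mul0r// mulr_ge0_le0 ?subr_le0.
by rewrite mulrC step_le0 ?mul0r// mulr_ge0_le0 ?subr_le0.
Qed.

Lemma box_bump_Cc k a b : Cc_infty (box_bump k a b).
Proof.
apply: (Cc_infty_compact (@compact_box a b)) => [x|n]; last exact: class_C_box_bump.
move=> /eqP; apply: contra_notP => abx; apply: box_bump_out => abx'; apply: abx.
by move=> i; have /andP[? ?] := abx' i; apply/andP; split; exact: ltW.
Qed.

Lemma box_bump_ge0 k a b x : 0 <= box_bump k a b x.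
Proof. by apply: prodr_ge0 => i _; rewrite mulr_ge0 ?step_ge0. Qed.

Lemma box_bump_le1 k a b x : box_bump k a b x <= 1.
Proof.
apply: prodr_ile1 => i _; rewrite mulr_ge0 ?step_ge0//=.
by rewrite mulr_ile1 ?step_ge0 ?step_le1.
Qed.

Lemma step_scaled_near (r : R) : 0 < r -> \forall k \near \oo, step (k%:R * r) = 1.
Proof.
move=> r0; near=> k; apply: step_ge1; rewrite -ler_pdivrMr// mul1r.
by near: k; exact: nbhs_infty_ger.
Unshelve. all: by end_near. Qed.

Lemma cvg_box_bump a b x :
  box_bump k a b x @[k --> \oo] --> (\1_(open_box a b) x : R).
Proof.
rewrite indicE; have [abx|abx] := pselect (open_box a b x); last first.
  rewrite memNset//; under eq_fun do rewrite box_bump_out//.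
  exact: cvg_cst.
rewrite mem_set//=; apply/cvgrPdist_le => e e0.
have : \forall k \near \oo, forall i : 'I_d,
    step (k%:R * (x i ord0 - a i ord0))
      * step (k%:R * (b i ord0 - x i ord0)) = 1.
  apply: filter_forall => i; have /andP[ax xb] := abx i.
  rewrite -subr_gt0 in ax; rewrite -subr_gt0 in xb.
  by apply: filterS2 (step_scaled_near ax) (step_scaled_near xb) => k -> ->;
    rewrite mulr1.
apply: filterS => k Hk.
by rewrite /box_bump big1 ?subrr ?normr0 ?ltW// => i _; exact: Hk.
Qed.

End borel_cV.

(** * Integrals, laws and the determination of measures *)

Section integration_tools.
Context {disp : measure_display} {T : measurableType disp} {R : realType}.

Lemma cvg_Rintegral (mu : {measure set T -> \bar R}) (f_ : (T -> R)^nat)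
    (f g : T -> R) :
  (forall n, measurable_fun setT (f_ n)) -> measurable_fun setT f ->
  (forall x, f_ n x @[n --> \oo] --> f x) ->
  mu.-integrable setT (EFin \o g) ->
  (forall n x, `|f_ n x| <= g x) ->
  \int[mu]_x f_ n x @[n --> \oo] --> \int[mu]_x f x.
Proof.
move=> mf_ mf cf ig fg.
have cEf x : (f_ n x)%:E @[n --> \oo] --> (f x)%:E.
  by apply/fine_cvgP; split; [exact: nearW|exact: cf].
have [intf _ cvf] := @dominated_convergence _ T R mu setT measurableT
  (fun n => EFin \o f_ n) (EFin \o f) (EFin \o g)
  (fun n => (measurable_EFinP _ _).2 (mf_ n)) ((measurable_EFinP _ _).2 mf)
  (aeW _ (fun x _ => cEf x)) ig
  (aeW _ (fun x n _ => fg n x)).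
apply: fine_cvg; rewrite fineK//; exact: integrable_fin_num intf.
Qed.

Lemma le_integrable_real (mu : {measure set T -> \bar R}) (f g : T -> R) :
  measurable_fun setT f -> mu.-integrable setT (EFin \o g) ->
  (forall x, `|f x| <= g x) -> mu.-integrable setT (EFin \o f).
Proof.
move=> mf ig fg; apply: le_integrable ig => //.
  exact/measurable_EFinP.
by move=> x _ /=; rewrite lee_fin (le_trans (fg x))// ler_norm.
Qed.

Lemma integrable_cst_prob (P : probability T R) (c : R) :
  P.-integrable setT (EFin \o (fun=> c)).
Proof. exact: finite_measure_integrable_cst. Qed.

Lemma integrable_bounded_prob (P : probability T R) (f : T -> R) (C : R) :
  measurable_fun setT f -> (forall x, `|f x| <= C) ->
  P.-integrable setT (EFin \o f).
Proof.
by move=> mf fC; exact: (le_integrable_real mf (integrable_cst_prob P C) fC).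
Qed.

Lemma integrableD_real (mu : {measure set T -> \bar R}) (f g : T -> R) :
  mu.-integrable setT (EFin \o f) -> mu.-integrable setT (EFin \o g) ->
  mu.-integrable setT (EFin \o (fun x => f x + g x)).
Proof.
by move=> intf intg; have := integrableD measurableT intf intg;
  apply: eq_integrable.
Qed.

Lemma integrableZ_real (mu : {measure set T -> \bar R}) (c : R) (f : T -> R) :
  mu.-integrable setT (EFin \o f) ->
  mu.-integrable setT (EFin \o (fun x => c * f x)).
Proof.
by move=> intf; have := integrableZl measurableT c intf; apply: eq_integrable.
Qed.

Lemma integrable_sum_real (mu : {measure set T -> \bar R}) (n : nat)
    (F : 'I_n -> T -> R) :
  (forall i, mu.-integrable setT (EFin \o F i)) ->
  mu.-integrable setT (EFin \o (fun x => \sum_i F i x)).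
Proof.
elim: n F => [|n IHn] F intF.
  under eq_fun do rewrite big_ord0.
  exact: integrable0.
under eq_fun do rewrite big_ord_recl.
by apply: integrableD_real => //; exact: IHn.
Qed.

Lemma Rintegral_sum_real (mu : {measure set T -> \bar R}) (n : nat)
    (F : 'I_n -> T -> R) :
  (forall i, mu.-integrable setT (EFin \o F i)) ->
  \int[mu]_x (\sum_i F i x) = \sum_i \int[mu]_x F i x.
Proof.
elim: n F => [|n IHn] F intF.
  under eq_Rintegral do rewrite big_ord0.
  by rewrite big_ord0 Rintegral_cst// mul0r.
under eq_Rintegral do rewrite big_ord_recl.
rewrite RintegralD//; last by apply: integrable_sum_real.
by rewrite IHn// big_ord_recl.
Qed.

Lemma Rintegral_cst_prob (P : probability T R) (c : R) : \int[P]_x c = c.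
Proof. by rewrite Rintegral_cst// [X in fine X](probability_setT P) mulr1. Qed.

End integration_tools.

Section law_transfer.
Context {disp disp' : measure_display} {T : measurableType disp}
  {S : measurableType disp'} {R : realType}.
Variables (P : probability T R) (mu : probability S R) (X : T -> S).
Hypothesis mX : measurable_fun setT X.
Hypothesis lawX : forall E, measurable E -> P (X @^-1` E) = mu E.

(** The law of X is described by its values on measurable sets, so that the
    marginals of a coupling and the law of a solution at time t are instances. *)
Lemma ge0_integral_law (f : S -> \bar R) :
  measurable_fun setT f -> (forall x, (0 <= f x)%E) ->
  (\int[P]_x f (X x) = \int[mu]_x f x)%E.
Proof.
move=> mf f0.
have := @ge0_integral_pushforward _ _ _ _ R X mX P setT f measurableT mf
  (fun y _ => f0 y).
rewrite preimage_setT => <-.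
by apply: eq_measure_integral => A mA _; exact: lawX.
Qed.

Lemma integrable_law (f : S -> R) : mu.-integrable setT (EFin \o f) ->
  P.-integrable setT (EFin \o (f \o X)).
Proof.
move=> /integrableP[mf f_fin]; apply/integrableP; split.
  exact: (measurableT_comp mf mX).
move: f_fin; rewrite -ge0_integral_law//.
exact: measurableT_comp.
Qed.

Lemma Rintegral_law (f : S -> R) : mu.-integrable setT (EFin \o f) ->
  \int[P]_x f (X x) = \int[mu]_x f x.
Proof.
move=> intf; have intfX := integrable_law intf; congr fine.
have mf : measurable_fun setT (EFin \o f) by case/integrableP: intf.
have := @integral_pushforward _ _ _ _ R X mX P setT (EFin \o f) mf.
rewrite preimage_setT => <- //.
by apply: eq_measure_integral => A mA _; exact: lawX.
Qed.

End law_transfer.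

Section measurable_vectors.
Context {disp : measure_display} {T : measurableType disp} {R : realType}.
Context {d : nat}.
Implicit Types g h : T -> 'cV[R]_d.

Lemma measurable_dot g h :
  (forall i, measurable_fun setT (fun x => g x i ord0)) ->
  (forall i, measurable_fun setT (fun x => h x i ord0)) ->
  measurable_fun setT (fun x => dot (g x) (h x)).
Proof.
move=> mg mh; under eq_fun do rewrite dotE.
by apply: measurable_sum => i; exact: measurable_funM.
Qed.

Lemma measurable_enorm g :
  (forall i, measurable_fun setT (fun x => g x i ord0)) ->
  measurable_fun setT (fun x => enorm (g x)).
Proof.
move=> mg; have msqrt : measurable_fun setT (@Num.sqrt R).
  by apply: continuous_measurable_fun; exact: sqrt_continuous.
exact: (measurableT_comp msqrt (measurable_dot mg mg)).
Qed.

Lemma measurable_sqr_enorm g :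
  (forall i, measurable_fun setT (fun x => g x i ord0)) ->
  measurable_fun setT (fun x => enorm (g x) ^+ 2).
Proof.
by move=> mg; under eq_fun do rewrite sqr_enorm; exact: measurable_dot.
Qed.

End measurable_vectors.

Section measure_determination.
Context {R : realType} {d : nat}.

(** Open boxes form a pi-system that generates the Borel sets, and the
    indicator of an open box is a bounded pointwise limit of smooth bumps. *)
Lemma Cc_infty_measure_unique (mu nu : probability 'cV[R]_d R) :
  (forall psi, Cc_infty psi -> \int[mu]_x psi x = \int[nu]_x psi x) ->
  forall E, measurable E -> mu E = nu E.
Proof.
move=> munu E mE.
pose g (k : nat) : set 'cV[R]_d :=
  open_box (const_mx (- k%:R)) (const_mx k%:R).
have mbox a b : measurable (@open_box R d a b).
  by apply: open_measurable_cV; exact: open_open_box.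
apply: (measure_unique open_boxes g) => //.
- exact: measurable_cV_boxes.
- exact: open_boxes_setI.
- by move=> k; do 2!eexists; reflexivity.
- apply/seteqP; split=> // x _.
  have : \forall k \near \oo, forall i : 'I_d, `|x i ord0| < k%:R.
    by apply: filter_forall => i; exact: nbhs_infty_gtr.
  case=> k _ /(_ k (leqnn k)) xk; exists k => // i.
  by rewrite !mxE -ltr_norml.
- move=> _ [a [b ->]].
  have cvgbox (P : probability 'cV[R]_d R) :
      \int[P]_x box_bump k a b x @[k --> \oo] --> fine (P (open_box a b)).
    have -> : fine (P (open_box a b)) = \int[P]_x (\1_(open_box a b) x).
      by rewrite /Rintegral integral_indic// setIT.
    apply: (@cvg_Rintegral _ _ _ _ _ _ (fun=> 1)).
    + move=> k; apply: continuous_measurable_cV.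
      exact: (class_C_continuous (class_C_box_bump 0 k a b)).
    + exact: measurable_indic.
    + by move=> x; exact: cvg_box_bump.
    + exact: integrable_cst_prob.
    + by move=> k x; rewrite ger0_norm ?box_bump_ge0 ?box_bump_le1.
  have cmu := cvgbox mu; have cnu := cvgbox nu.
  have Efine : fine (mu (open_box a b)) = fine (nu (open_box a b)).
    have E' : (fun k => \int[mu]_x box_bump k a b x) =
        (fun k => \int[nu]_x box_bump k a b x).
      by apply/funext => k; apply: munu; exact: box_bump_Cc.
    by rewrite E' in cmu; exact: cvg_unique cmu cnu.
  rewrite -[LHS]fineK; last exact: fin_num_measure.
  by rewrite Efine fineK//; exact: fin_num_measure.
- by move=> k; apply: le_lt_trans (probability_le1 mu _) (ltry 1); exact: mbox.
Qed.

End measure_determination.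

(** * Second moments, couplings and the Wasserstein distance *)

Section finite_second_moment.
Context {R : realType} {d : nat}.
Implicit Types (m mu nu : P2 R d) (x y : 'cV[R]_d).

Lemma P2_integrable_sqr_enorm m :
  m.-integrable setT (EFin \o (fun x => enorm x ^+ 2)).
Proof.
have mf : measurable_fun setT (fun x : 'cV[R]_d => enorm x ^+ 2).
  by apply: measurable_sqr_enorm => i; exact: measurable_coord.
apply/integrableP; split; first exact/measurable_EFinP.
apply: le_lt_trans (P2_moment m); rewrite le_eqVlt; apply/orP; left; apply/eqP.
by apply: eq_integral => x _; rewrite /= ger0_norm// sqr_ge0.
Qed.

Lemma P2_integrable m (h : 'cV[R]_d -> R) (C : R) :
  measurable_fun setT h -> (forall x, `|h x| <= C * (1 + enorm x ^+ 2)) ->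
  m.-integrable setT (EFin \o h).
Proof.
move=> mh hC; apply: (le_integrable_real mh _ hC).
apply: integrableZ_real; apply: integrableD_real.
  exact: integrable_cst_prob.
exact: P2_integrable_sqr_enorm.
Qed.

Lemma enorm_le1Dsqr x : enorm x <= 1 + enorm x ^+ 2.
Proof. by have := enorm_ge0 x; nra. Qed.

Lemma P2_integrable_coord m i : m.-integrable setT (EFin \o (fun x => x i ord0)).
Proof.
apply: (@P2_integrable _ _ 1); first exact: measurable_coord.
move=> x; rewrite mul1r (le_trans (coord_le_enorm x i))//.
exact: enorm_le1Dsqr.
Qed.

Lemma P2_integrable_enorm m : m.-integrable setT (EFin \o (@enorm R d)).
Proof.
apply: (@P2_integrable _ _ 1).
  by apply: (measurable_enorm (g := id)) => i; exact: measurable_coord.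
by move=> x; rewrite mul1r ger0_norm ?enorm_ge0 ?enorm_le1Dsqr.
Qed.

Lemma sqr_enormB_le x y : enorm (x - y) ^+ 2 <= 2 * enorm x ^+ 2 + 2 * enorm y ^+ 2.
Proof.
rewrite !sqr_enorm -subr_ge0; set l := (X in 0 <= X).
suff -> : l = dot (x + y) (x + y) by exact: dot_ge0.
rewrite /l !(dotDl, dotDr, dotNl, dotNr) (dotC y x); ring.
Qed.

End finite_second_moment.

Section couplings.
Context {R : realType} {d : nat}.
Implicit Types (mu nu : P2 R d).
Local Notation E := 'cV[R]_d.

Lemma coupling_fst (mu nu : probability E R) (gamma : probability (E * E)%type R) :
  coupling mu nu gamma -> forall A, measurable A -> gamma (fst @^-1` A) = mu A.
Proof.
move=> cg A mA; have [<- _] := cg A mA; congr (gamma _).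
by apply/seteqP; split=> -[a b] //= [].
Qed.

Lemma coupling_snd (mu nu : probability E R) (gamma : probability (E * E)%type R) :
  coupling mu nu gamma -> forall A, measurable A -> gamma (snd @^-1` A) = nu A.
Proof.
move=> cg A mA; have [_ <-] := cg A mA; congr (gamma _).
by apply/seteqP; split=> -[a b] //= [].
Qed.

Lemma measurable_sub_coord i :
  measurable_fun setT (fun z : E * E => (z.1 - z.2) i ord0).
Proof.
under eq_fun do rewrite !mxE.
by apply: measurable_funB;
  [apply: (measurableT_comp (measurable_coord i))|
   apply: (measurableT_comp (measurable_coord i))].
Qed.

Section fixed_coupling.
Variables (mu nu : P2 R d) (gamma : probability (E * E)%type R).
Hypothesis cg : coupling mu nu gamma.

Lemma coupling_integrable_fst (h : E -> R) :
  mu.-integrable setT (EFin \o h) ->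
  gamma.-integrable setT (EFin \o (fun z => h z.1)).
Proof. exact: (integrable_law measurable_fst (coupling_fst cg)). Qed.

Lemma coupling_integrable_snd (h : E -> R) :
  nu.-integrable setT (EFin \o h) ->
  gamma.-integrable setT (EFin \o (fun z => h z.2)).
Proof. exact: (integrable_law measurable_snd (coupling_snd cg)). Qed.

Lemma coupling_Rintegral_fst (h : E -> R) :
  mu.-integrable setT (EFin \o h) ->
  \int[gamma]_z h z.1 = \int[mu]_x h x.
Proof. exact: (Rintegral_law measurable_fst (coupling_fst cg)). Qed.

Lemma coupling_Rintegral_snd (h : E -> R) :
  nu.-integrable setT (EFin \o h) ->
  \int[gamma]_z h z.2 = \int[nu]_x h x.
Proof. exact: (Rintegral_law measurable_snd (coupling_snd cg)). Qed.

Lemma coupling_integrable_cost :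
  gamma.-integrable setT (EFin \o (fun z => enorm (z.1 - z.2) ^+ 2)).
Proof.
apply: (@le_integrable_real _ _ _ _ _
    (fun z => 2 * enorm z.1 ^+ 2 + 2 * enorm z.2 ^+ 2)).
- by apply: measurable_sqr_enorm => i; exact: measurable_sub_coord.
- apply: integrableD_real; apply: integrableZ_real.
    exact: (coupling_integrable_fst (P2_integrable_sqr_enorm mu)).
  exact: (coupling_integrable_snd (P2_integrable_sqr_enorm nu)).
- by move=> z; rewrite ger0_norm ?sqr_ge0// sqr_enormB_le.
Qed.

Lemma coupling_costE :
  (\int[gamma]_z (enorm (z.1 - z.2) ^+ 2)%:E)%E =
  (\int[gamma]_z (enorm (z.1 - z.2) ^+ 2))%:E.
Proof. by rewrite fineK//; exact: (integrable_fin_num _ coupling_integrable_cost). Qed.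

(** The infimum in W2 lies between 0 and c, hence is finite and fine preserves
    the inequality. *)
Lemma W2_le_coupling (c : R) : 
  \int[gamma]_z (enorm (z.1 - z.2) ^+ 2) <= c -> W2 mu nu <= Num.sqrt c.
Proof.
move=> gc; rewrite /W2; apply: ler_wsqrtr.
set I := ereal_inf _.
have I0 : (0 <= I)%E.
  apply: le_ereal_inf_tmp => _ [g _ <-]; apply: integral_ge0 => z _.
  by rewrite lee_fin sqr_ge0.
have Ic : (I <= c%:E)%E.
  apply: (@le_trans _ _ (\int[gamma]_z (enorm (z.1 - z.2) ^+ 2)%:E)%E).
    by apply: ereal_inf_lbound; exists gamma.
  by rewrite coupling_costE lee_fin.
have If : I \is a fin_num by rewrite ge0_fin_numE// (le_lt_trans Ic)// ltry.
by rewrite -lee_fin fineK.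
Qed.

End fixed_coupling.

Lemma coupling_prod mu nu : coupling mu nu (mu \x nu)%E.
Proof.
move=> A mA; split.
  rewrite [LHS](product_measure1E mu nu mA measurableT).
  by rewrite [X in (_ * X)%E](probability_setT nu) mule1.
rewrite [LHS](product_measure1E mu nu measurableT mA).
by rewrite [X in (X * _)%E](probability_setT mu) mul1e.
Qed.

Lemma W2_ge0 mu nu : 0 <= W2 mu nu.
Proof. exact: sqrtr_ge0. Qed.

(** The product coupling has a finite cost, so the infimum is not +oo, a value
    that fine would send to 0. *)
Lemma W2_lt_coupling mu nu (s : R) : W2 mu nu < s ->
  exists2 gamma, coupling mu nu gamma &
    \int[gamma]_z (enorm (z.1 - z.2) ^+ 2) < s ^+ 2.
Proof.
move=> Ws; have s0 : 0 < s by exact: le_lt_trans (W2_ge0 mu nu) Ws.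
move: Ws; rewrite /W2; set I := ereal_inf _ => Ws.
have I0 : (0 <= I)%E.
  apply: le_ereal_inf_tmp => _ [g _ <-]; apply: integral_ge0 => z _.
  by rewrite lee_fin sqr_ge0.
have Ic : (I < +oo)%E.
  apply: (@le_lt_trans _ _
    (\int[mu \x nu]_z (enorm (z.1 - z.2) ^+ 2)%:E)%E).
    by apply: ereal_inf_lbound; exists (mu \x nu)%E; first exact: coupling_prod.
  by rewrite (coupling_costE (coupling_prod mu nu)) ltry.
have If : I \is a fin_num by rewrite ge0_fin_numE.
have : (I < (s ^+ 2)%:E)%E.
  rewrite -(fineK If) lte_fin.
  rewrite -[fine I]sqr_sqrtr ?fine_ge0// ltr_pXn2r// ?nnegrE ?sqrtr_ge0//.
  exact: ltW.
move=> /ereal_inf_lt[_ [gamma cg <-]]; rewrite (coupling_costE cg) lte_fin.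
by exists gamma.
Qed.

(** Both integrals live on a common almost optimal coupling, where the Lipschitz
    bound applies pointwise. *)
Lemma Rintegral_lipschitz_W2 mu nu (h : E -> R) (L : R) :
  0 <= L -> measurable_fun setT h ->
  (forall x y, `|h x - h y| <= L * enorm (x - y)) ->
  mu.-integrable setT (EFin \o h) -> nu.-integrable setT (EFin \o h) ->
  `|\int[mu]_x h x - \int[nu]_x h x| <= L * W2 mu nu.
Proof.
move=> L0 mh hL imu inu.
have step (s : R) : W2 mu nu < s -> `|\int[mu]_x h x - \int[nu]_x h x| <= L * s.
  move=> Ws; have s0 : 0 < s by exact: le_lt_trans (W2_ge0 mu nu) Ws.
  have [gamma cg gs] := W2_lt_coupling Ws.
  have i1 := coupling_integrable_fst cg imu.
  have i2 := coupling_integrable_snd cg inu.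
  have ic := coupling_integrable_cost cg.
  rewrite -(coupling_Rintegral_fst cg imu) -(coupling_Rintegral_snd cg inu).
  rewrite -RintegralB//.
  have i12 : gamma.-integrable setT (EFin \o (fun z => h z.1 - h z.2)).
    have := integrableD_real i1 (integrableZ_real (-1) i2).
    by apply: eq_integrable => // z _; rewrite /= mulN1r.
  apply: le_trans (le_normr_Rintegral _ i12) _ => //.
  (* a <= (s + a ^ 2 / s) / 2 replaces the Cauchy-Schwarz inequality *)
  have Ls0 : 0 <= L / (2 * s) by rewrite divr_ge0// mulr_ge0// ltW.
  pose u (z : E * E) := L * s / 2 + L / (2 * s) * enorm (z.1 - z.2) ^+ 2.
  have iu : gamma.-integrable setT (EFin \o u).
    apply: integrableD_real; first exact: integrable_cst_prob.
    exact: integrableZ_real.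
  apply: (@le_trans _ _ (\int[gamma]_z u z)).
    apply: le_Rintegral => //; first exact: (integrable_norm i12).
    move=> z _; apply: le_trans (hL _ _) _; rewrite /u.
    move: (enorm _) => a.
    have -> : L * s / 2 + L / (2 * s) * a ^+ 2 =
        L * a + L / (2 * s) * (s - a) ^+ 2.
      by field; rewrite gt_eqF.
    by rewrite lerDl; apply: mulr_ge0; [exact: Ls0|exact: sqr_ge0].
  rewrite /u RintegralD//; last 2 first.
    exact: integrable_cst_prob.
    exact: integrableZ_real.
  rewrite Rintegral_cst_prob RintegralZl//.
  apply: (@le_trans _ _ (L * s / 2 + L / (2 * s) * s ^+ 2)).
    rewrite lerD2l; apply: ler_wpM2l; last exact: ltW.
    exact: Ls0.
  suff -> : L * s / 2 + L / (2 * s) * s ^+ 2 = L * s by [].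
  by field; rewrite gt_eqF.
apply/ler_addgt0Pr => e e0.
have eL : 0 < e / (L + 1) by rewrite divr_gt0// ltr_wpDl.
apply: (le_trans (step (W2 mu nu + e / (L + 1)) _)); first by rewrite ltrDl.
rewrite mulrDr lerD2l mulrCA; apply: ler_piMr; first exact: ltW.
by rewrite ler_pdivrMr ?ltr_wpDl// mul1r lerDl.
Qed.

End couplings.

(** * Weak derivatives and Gronwall's argument *)

Section step_derivative.
Context {R : realType}.
Implicit Types x : R.

Definition dflat1 x : R := flat ('X^2 : {poly R}) x.

(** The derivative of step.  As it is nonnegative, vanishes outside [0, 1] and
    has integral 1, the functions n dstep (n (r - c)) are mollifiers on
    [c, c + 1 / n]. *)
Definition dstep x : R :=
  (dflat1 x * flat 1 (1 - x) + flat 1 x * dflat1 (1 - x))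
  / (flat 1 x + flat 1 (1 - x)) ^+ 2.

Lemma dflat1_ge0 x : 0 <= dflat1 x.
Proof.
rewrite /dflat1 /flat; case: ifP => // x0.
by rewrite hornerXn mulr_ge0 ?expR_ge0// sqr_ge0.
Qed.

Lemma is_derive_flat1 x : is_derive x (1 : R) (flat 1) (dflat1 x).
Proof.
have := is_derive_flat (1 : {poly R}) x.
by rewrite derivC subr0 mul1r.
Qed.

Lemma is_derive_step x : is_derive x (1 : R) step (dstep x).
Proof.
have dr : is_derive x (1 : R) (fun z => flat 1 (1 - z) : R) (- dflat1 (1 - x)).
  have dN : is_derive x (1 : R) (fun z : R => 1 - z) (- 1).
    apply: (is_derive_eq (is_deriveB (is_derive_cst (1 : R) x 1)
      (is_derive_id x 1))).
    by rewrite sub0r.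
  apply: (is_derive_eq (@is_derive1_comp R (flat 1) (fun z => 1 - z) x _ _
    (is_derive_flat1 (1 - x)) dN)).
  by rewrite mulrN1.
have dD : is_derive x (1 : R) (fun z => flat 1 z + flat 1 (1 - z) : R)
    (dflat1 x - dflat1 (1 - x)) := is_deriveD (is_derive_flat1 x) dr.
have D0 : flat 1 x + flat 1 (1 - x) != 0 by rewrite gt_eqF// step_den_gt0.
have dV := @is_deriveV R (fun z => flat 1 z + flat 1 (1 - z)) _ _ _ D0 dD.
apply: (is_derive_eq (is_deriveM (is_derive_flat1 x) dV)).
rewrite /GRing.scale/= /dstep.
by field.
Qed.

Lemma dstep_ge0 x : 0 <= dstep x.
Proof.
rewrite divr_ge0 ?sqr_ge0// addr_ge0// mulr_ge0 ?dflat1_ge0//; exact: flat1_ge0.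
Qed.

Lemma dstep_le0 x : x <= 0 -> dstep x = 0.
Proof.
by move=> x0; rewrite /dstep /dflat1 !(flat_le0 _ x0) !mul0r add0r mul0r.
Qed.

Lemma dstep_ge1 x : 1 <= x -> dstep x = 0.
Proof.
move=> x1; rewrite /dstep /dflat1 !(@flat_le0 _ _ (1 - x)) ?subr_le0//.
by rewrite !mulr0 addr0 mul0r.
Qed.

Lemma continuous_dstep : continuous dstep.
Proof.
apply: (@class_C_continuous _ _ 0).
have C1 : class_C 0 (fun x : R => 1 - x).
  apply: class_CB; first exact: class_C_cst.
  by apply: (@class_C_linear _ _ _ idfun) => x; exact: cvg_id.
have Cf p : class_C 0 (fun x : R => flat p (1 - x)).
  by apply: (@class_C_comp_real _ _ _ (flat p)) => //; exact: class_C_flat.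
have Cd p : class_C 0 (fun x : R => flat p x) by exact: class_C_flat.
have CD : class_C 0 (fun x : R => flat 1 x + flat 1 (1 - x)).
  by apply: class_CD; [exact: Cd|exact: Cf].
apply: class_CM.
  by apply: class_CD; apply: class_CM; [exact: Cd|exact: Cf|exact: Cd|exact: Cf].
apply: class_CV => [x|]; first by rewrite expf_eq0/= gt_eqF// step_den_gt0.
apply: (class_C_ext _ (class_CM CD CD)) => x; by rewrite expr2.
Qed.

Lemma is_derive_step_affine (n c x : R) :
  is_derive x (1 : R) (fun r => step (n * (r - c))) (n * dstep (n * (x - c))).
Proof.
have dA : is_derive x (1 : R) (fun r : R => n * (r - c)) n.
  apply: (is_derive_eq (is_deriveM (is_derive_cst n x 1)
    (is_deriveB (is_derive_id x 1) (is_derive_cst c x 1)))).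
  by rewrite /GRing.scale/= subr0 mulr1 mulr0 addr0.
apply: (is_derive_eq (@is_derive1_comp R step (fun r => n * (r - c)) x _ _
  (is_derive_step _) dA)).
by rewrite mulrC.
Qed.

Lemma class_C_step_affine k (n c : R) : class_C k (fun r => step (n * (r - c))).
Proof.
apply: (@class_C_comp_real _ _ _ step); first exact: class_C_step.
apply: class_CM; first exact: class_C_cst.
apply: class_CB; last exact: class_C_cst.
by apply: (@class_C_linear _ _ _ idfun) => x; exact: cvg_id.
Qed.

End step_derivative.

Section du_bois_reymond.
Context {R : realType}.
Notation mu := (@lebesgue_measure R).

Lemma integrable_continuous_itv (f : R -> R) (a b : R) :
  continuous f -> mu.-integrable `[a, b] (EFin \o f).
Proof.
move=> cf; apply: continuous_compact_integrable; first exact: segment_compact.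
exact: continuous_subspaceT.
Qed.

Lemma continuous_dstep_affine (n c : R) :
  continuous (fun r : R => n * dstep (n * (r - c))).
Proof.
move=> r; apply: cvgM; first exact: cvg_cst.
apply: (@continuous_comp R R R (fun r => n * (r - c)) dstep);
  last exact: continuous_dstep.
by apply: cvgM; [exact: cvg_cst|apply: cvgB; [exact: cvg_id|exact: cvg_cst]].
Qed.

Lemma Rintegral_dstep_affine (n c T : R) : 0 < n -> 0 <= c -> c + n^-1 <= T ->
  \int[mu]_(r in `[0, T]) (n * dstep (n * (r - c))) = 1.
Proof.
move=> n0 c0 cT; have T0 : 0 < T.
  by rewrite (lt_le_trans _ cT)// ltr_wpDl// invr_gt0.
have dF r := is_derive_step_affine n c r.
have cF : continuous (fun r => step (n * (r - c))).
  exact: class_C_continuous (class_C_step_affine 0 n c).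
rewrite /Rintegral (@continuous_FTC2 _ _ (fun r => step (n * (r - c))) 0 T)//.
- have -> : step (n * (T - c)) = 1.
    by apply: step_ge1; rewrite -ler_pdivrMl// mulr1 lerBrDl.
  have -> : step (n * (0 - c)) = 0.
    by apply: step_le0; rewrite sub0r mulrN oppr_le0 mulr_ge0// ltW.
  by rewrite sube0.
- exact/continuous_subspaceT/continuous_dstep_affine.
- split.
  + by move=> r _; have [] := dF r.
  + exact/cvg_at_right_filter/cF.
  + exact/cvg_at_left_filter/cF.
- by move=> r _; rewrite derive1E; have [_ ->] := dF r.
Qed.

(** The mollifier has mass 1 on [0, T], so the difference is an average of
    g r - v over [c, c + 1 / n]. *)
Lemma mollified_value (g : R -> R) (n c T v e : R) :
  continuous g -> 0 < n -> 0 <= c -> c + n^-1 <= T ->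
  (forall r, c <= r <= c + n^-1 -> `|g r - v| <= e) ->
  `|\int[mu]_(r in `[0, T]) (n * dstep (n * (r - c)) * g r) - v| <= e.
Proof.
move=> cg n0 c0 cT gv.
set rho := fun r => n * dstep (n * (r - c)).
have crho : continuous rho by exact: continuous_dstep_affine.
have rho0 r : 0 <= rho r by rewrite mulr_ge0 ?dstep_ge0 ?ltW.
have irho : mu.-integrable `[0, T] (EFin \o rho) by exact: integrable_continuous_itv.
have crhog : continuous (fun r => rho r * g r).
  by move=> r; apply: cvgM; [exact: crho|exact: cg].
have -> : v = \int[mu]_(r in `[0, T]) (rho r * v).
  by rewrite RintegralZr// Rintegral_dstep_affine// mul1r.
have iv : mu.-integrable `[0, T] (EFin \o (fun r => rho r * v)).
  by apply: integrable_continuous_itv => r; apply: cvgM; [exact: crho|exact: cvg_cst].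
rewrite -RintegralB//; last exact: integrable_continuous_itv.
have cB : continuous (fun r => rho r * g r - rho r * v).
  move=> r; apply: cvgB; first exact: crhog.
  by apply: cvgM; [exact: crho|exact: cvg_cst].
have iB := integrable_continuous_itv 0 T cB.
apply: le_trans (le_normr_Rintegral _ iB) _ => //.
have -> : e = \int[mu]_(r in `[0, T]) (rho r * e).
  by rewrite RintegralZr// Rintegral_dstep_affine// mul1r.
apply: le_Rintegral => //.
- exact: integrable_norm.
- by apply: integrable_continuous_itv => r; apply: cvgM; [exact: crho|exact: cvg_cst].
- move=> r _; rewrite -mulrBr normrM ger0_norm//.
  have [cr|rc] := leP c r; last first.
    by rewrite /rho dstep_le0 ?mulr0 ?mul0r// mulr_ge0_le0 ?subr_le0 ?ltW.
  have [rcn|cnr] := leP r (c + n^-1); first by rewrite ler_wpM2l// gv// cr.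
  rewrite /rho dstep_ge1 ?mulr0 ?mul0r//.
  by rewrite -ler_pdivrMl// mulr1 lerBrDl ltW.
Qed.

(** The quantitative form of the du Bois-Reymond lemma: k is the derivative of
    g in the weak sense.  A smooth trapezoid eta, with values in [0, 1] and
    support in ]a, b], has for derivative a mollifier near a minus a mollifier
    near b; it tests g at both ends, and the integral of eta k is at most
    K (b - a). *)
Lemma weak_derivative_increment (g k : R -> R) (T a b K : R) :
  continuous g -> continuous k -> 0 <= a -> a < b -> b < T ->
  (forall r, a <= r <= b -> `|k r| <= K) ->
  (forall eta, Cc_infty eta -> support_closure eta `<=` [set t | 0 < t < T] ->
     \int[mu]_(r in `[0, T]) (derive1 eta r * g r + eta r * k r) = 0) ->
  `|g b - g a| <= K * (b - a).
Proof.
move=> cg ck a0 ab bT kK weak.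
have K0 : 0 <= K by apply: le_trans (kK a _); rewrite ?normr_ge0// lexx ltW.
apply/ler_addgt0Pr => e e0.
have e20 : 0 < e / 2 by rewrite divr_gt0.
have /cvgrPdist_le/(_ _ e20)/nbhs_ballP[d1 /= d10 gd1] := cg a.
have /cvgrPdist_le/(_ _ e20)/nbhs_ballP[d2 /= d20 gd2] := cg b.
pose d := Num.min (Num.min d1 d2) (b - a).
have d0 : 0 < d by rewrite !lt_min d10 d20 subr_gt0.
have dd1 : d <= d1 by rewrite !ge_min lexx.
have dd2 : d <= d2 by rewrite !ge_min lexx orbT.
have dba : d <= b - a by rewrite !ge_min lexx !orbT.
pose h := d / 4; have h0 : 0 < h by rewrite divr_gt0.
have h4 : d = 4 * h by rewrite mulrC divfK.
pose n := h^-1; have n0 : 0 < n by rewrite invr_gt0.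
have nV : n^-1 = h by rewrite invrK.
(* The ramps are [a + h, a + 2 h] and [b - h, b]: the first one starts after a,
   which keeps the support inside ]0, T[ when a = 0. *)
pose p := a + h; pose q := b - h.
pose eta r := step (n * (r - p)) - step (n * (r - q)).
have deta r : is_derive r (1 : R) eta
    (n * dstep (n * (r - p)) - n * dstep (n * (r - q))).
  exact: is_deriveB (is_derive_step_affine n p r) (is_derive_step_affine n q r).
have Ceta j : class_C j eta.
  by apply: class_CB; exact: class_C_step_affine.
have pq : p <= q by rewrite /p /q; lra.
have step0 r c : r <= c -> step (n * (r - c)) = 0.
  by move=> rc; rewrite step_le0// pmulr_rle0// subr_le0.
have step1 r c : c + h <= r -> step (n * (r - c)) = 1.
  by move=> cr; rewrite step_ge1// -ler_pdivrMl// mulr1 nV lerBrDl.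
have eta_le r : r <= p -> eta r = 0.
  by move=> rp; rewrite /eta !step0 ?subrr// (le_trans rp).
have eta_ge r : b <= r -> eta r = 0.
  move=> br; rewrite /eta !step1 ?subrr//; first by rewrite /q subrK.
  by apply: le_trans br; rewrite /p; lra.
have eta_itv r : eta r != 0 -> p <= r <= b.
  move=> r0; rewrite !leNgt; apply/andP; split; apply: contra r0 => H.
    by rewrite eta_le// ltW.
  by rewrite eta_ge// ltW.
have eta1 r : `|eta r| <= 1.
  rewrite ler_norml /eta.
  have := step_ge0 (n * (r - p)); have := step_ge0 (n * (r - q)).
  have := step_le1 (n * (r - p)); have := step_le1 (n * (r - q)).
  by move=> *; apply/andP; split; lra.
have Cceta : Cc_infty eta.
  apply: (Cc_infty_compact (@segment_compact _ p b)) => // r /eta_itv.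
have supp : support_closure eta `<=` [set t | 0 < t < T].
  have H : support_closure eta `<=` `[p, b]%classic.
    rewrite [X in _ `<=` X](closure_id _).1; last exact: interval_closed.
    by apply: closure_subset => r /eta_itv; rewrite /= in_itv.
  move=> r /H; rewrite /= in_itv/= => /andP[pr rb].
  by rewrite (le_lt_trans rb bT) andbT (lt_le_trans _ pr)// /p ltr_wpDl.
have ceta : continuous eta by exact: class_C_continuous (Ceta 0).
have derE r : derive1 eta r = n * dstep (n * (r - p)) - n * dstep (n * (r - q)).
  by rewrite derive1E; have [_ ->] := deta r.
have := weak _ Cceta supp.
have cA c : continuous (fun r => n * dstep (n * (r - c)) * g r).
  by move=> r; apply: cvgM; [exact: continuous_dstep_affine|exact: cg].
have cEk : continuous (fun r => eta r * k r).
  by move=> r; apply: cvgM; [exact: ceta|exact: ck].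
set Ip := \int[mu]_(r in `[0, T]) (n * dstep (n * (r - p)) * g r).
set Iq := \int[mu]_(r in `[0, T]) (n * dstep (n * (r - q)) * g r).
set Ik := \int[mu]_(r in `[0, T]) (eta r * k r).
have -> : \int[mu]_(r in `[0, T]) (derive1 eta r * g r + eta r * k r) =
    Ip - Iq + Ik.
  under eq_Rintegral do rewrite derE mulrBl.
  rewrite RintegralD//; first last.
  - exact: integrable_continuous_itv.
  - by apply: integrable_continuous_itv => r; apply: cvgB; exact: cA.
  by rewrite RintegralB//; exact: integrable_continuous_itv.
move=> weak0.
have Ipa : `|Ip - g a| <= e / 2.
  apply: mollified_value => //.
  - by rewrite /p; lra.
  - by rewrite nV /p; lra.
  - move=> r; rewrite nV => /andP[pr rp]; rewrite distrC; apply: gd1.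
    by rewrite /ball/= ltr_norml; apply/andP; split; rewrite /p in pr rp; lra.
have Iqb : `|Iq - g b| <= e / 2.
  apply: mollified_value => //.
  - by rewrite /q; lra.
  - by rewrite nV /q; lra.
  - move=> r; rewrite nV => /andP[qr rq]; rewrite distrC; apply: gd2.
    by rewrite /ball/= ltr_norml; apply/andP; split; rewrite /q in qr rq; lra.
have Ikb : `|Ik| <= K * (b - a).
  apply: le_trans (le_normr_Rintegral _ (integrable_continuous_itv 0 T cEk)) _ => //.
  have sub : `[a, b] `<=` `[0, T]%classic.
    by apply: subset_itv; rewrite bnd_simp// ltW.
  have -> : K * (b - a) = \int[mu]_(r in `[0, T]) (K * \1_(`[a, b]%classic) r).
    rewrite RintegralZl//; last first.
      by apply: integrableS (integrable_indic_itv a b true false).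
    have mab : mu `[a, b]%classic = (b - a)%:E.
      by rewrite lebesgue_measure_itv/= lte_fin ab EFinB.
    rewrite /Rintegral integral_indic//.
    by rewrite [X in fine X](_ : _ = (b - a)%:E)// -mab setIidl.
  apply: le_Rintegral => //.
  - by apply: integrable_norm => //; exact: integrable_continuous_itv.
  - apply: integrableS (_ : mu.-integrable setT _) => //.
    have := integrableZl measurableT K (integrable_indic_itv a b true false).
    by apply: eq_integrable.
  move=> r _; have [/eqP->|/eta_itv/andP[pr rb]] := boolP (eta r == 0).
    by rewrite mul0r normr0 mulr_ge0// indicE.
  have ar : a <= r by apply: le_trans pr; rewrite /p lerDl ltW.
  rewrite indicE mem_set/=; last by rewrite in_itv/= ar.
  rewrite mulr1 normrM -[leRHS]mul1r ler_pM//.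
  by apply: kK; rewrite ar.
move: Ipa Iqb Ikb; rewrite !ler_norml => /andP[? ?] /andP[? ?] /andP[? ?].
by apply/andP; split; lra.
Qed.

(** On an interval of length tau with C tau <= 1 / 2 that starts at a zero of W,
    the maximum S of W satisfies S <= S / 2.  Finitely many such intervals cover
    [0, t]. *)
Lemma gronwall_zero (W : R -> R) (C T : R) :
  continuous W -> (forall t, 0 <= W t) -> W 0 = 0 -> 0 <= C ->
  (forall s t S, 0 <= s -> s < t -> t < T ->
     (forall r, s <= r <= t -> W r <= S) -> W t <= W s + C * (t - s) * S) ->
  forall t, 0 <= t < T -> W t = 0.
Proof.
move=> cW W_ge0 W0 C0 HW.
pose tau := (2 * (C + 1))^-1.
have C1 : 0 < C + 1 by rewrite ltr_wpDl.
have tau0 : 0 < tau by rewrite invr_gt0 mulr_gt0.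
have Ctau : C * tau <= 2^-1.
  rewrite /tau invfM mulrCA ler_piMr ?invr_ge0//.
  by rewrite ler_pdivrMr// mul1r lerDl.
have local_step s t : 0 <= s -> s < t -> t < T -> t - s <= tau -> W s = 0 ->
    W t = 0.
  move=> s0 st tT ts Ws.
  have [r] := EVT_max (ltW st) (continuous_subspaceT cW).
  rewrite in_itv/= => /andP[sr rt] Wmax.
  suff Wr0 : W r <= 0.
    apply/eqP; rewrite eq_le W_ge0 andbT (le_trans _ Wr0)// Wmax// in_itv/=.
    by rewrite lexx ltW.
  have [<-|sr'] := eqVneq s r; first by rewrite Ws.
  have {}sr' : s < r by rewrite lt_neqAle sr'.
  have := HW s r (W r) s0 sr' (le_lt_trans rt tT).
  rewrite Ws add0r => H.
  have {}H : W r <= C * (r - s) * W r.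
    apply: H => u /andP[su ur]; apply: Wmax; rewrite in_itv/= su.
    exact: le_trans ur rt.
  have : C * (r - s) <= 2^-1.
    apply: le_trans Ctau; rewrite ler_wpM2l//; lra.
  move=> H2; have := le_trans H (ler_wpM2r (W_ge0 r) H2).
  by have := W_ge0 r; lra.
have main n t : 0 <= t -> t < T -> t <= n%:R * tau -> W t = 0.
  elim: n t => [|n IHn] t t0 tT.
    by rewrite mul0r => t0'; have -> : t = 0 by apply/le_anti; rewrite t0 t0'.
  move=> tn; have [|ntau] := leP t (n%:R * tau); first exact: IHn.
  have ntau0 : 0 <= n%:R * tau by rewrite mulr_ge0// ltW.
  apply: (local_step (n%:R * tau)) => //.
    by move: tn; rewrite -natr1 mulrDl mul1r lerBlDl.
  by apply: IHn => //; exact: lt_trans tT.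
move=> t /andP[t0 tT].
apply: (main (Num.bound (t / tau))) => //.
by rewrite -ler_pdivrMr// ltW// archi_boundP// divr_ge0// ltW.
Qed.

End du_bois_reymond.

(** * Compactly supported smooth functions *)

Section Cc_infty_theory.
Context {R : realType} {d : nat}.
Implicit Types (psi : 'cV[R]_d -> R) (x y v : 'cV[R]_d).

Lemma enorm_le_sum x : enorm x <= \sum_i `|x i ord0|.
Proof.
rewrite -(@ger0_norm _ (\sum_i _)); last by apply: sumr_ge0.
rewrite -sqrtr_sqr; apply: ler_wsqrtr; rewrite dotE expr2 mulr_suml.
apply: ler_sum => i _; rewrite -[leLHS]ger0_norm; last first.
  by rewrite -expr2 sqr_ge0.
rewrite normrM ler_wpM2l// (bigD1 i)//= lerDl.
by apply: sumr_ge0.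
Qed.

Lemma Cc_infty_derive psi v : Cc_infty psi -> Cc_infty ('D_v psi).
Proof.
move=> [Cpsi cK]; apply: (Cc_infty_compact cK) => [z|n]; last first.
  by have [_] := (class_CS _ _).1 (Cpsi n.+1); apply.
apply: contraPP => zK; apply/negP; rewrite negbK; apply/eqP.
have oK : open (~` support_closure psi).
  by apply: closed_openC; exact: closed_closure.
have : nbhs z (~` support_closure psi) by exact: open_nbhs_nbhs.
move=> nz; rewrite (@near_eq_derive _ _ _ psi (cst 0)).
  by rewrite derive_cst.
apply: filterS nz => u uK; apply: contra_notP uK => /eqP u0.
exact: subset_closure.
Qed.

Lemma Cc_infty_bounded psi : Cc_infty psi ->
  exists2 C : R, 0 <= C & forall x, `|psi x| <= C.
Proof.
move=> [Cpsi cK].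
have cpsi : continuous psi by exact: class_C_continuous (Cpsi 0).
have : compact (psi @` support_closure psi).
  by apply: continuous_compact => //; exact: continuous_subspaceT.
move=> /compact_bounded[M [_ HM]].
exists (`|M| + 1) => [|x]; first by rewrite addr_ge0.
have [->|x0] := eqVneq (psi x) 0; first by rewrite normr0 addr_ge0.
apply: HM; first by rewrite ltr_pwDr// ler_norm.
by exists x => //; exact: subset_closure.
Qed.

(** The mean value theorem along the segment from y to x. *)
Lemma bounded_gradient_lipschitz psi (C : 'I_d -> R) :
  (forall x, differentiable psi x) ->
  (forall i x, `|'D_(delta_mx i ord0) psi x| <= C i) ->
  forall x y, `|psi x - psi y| <= (\sum_i C i) * enorm (x - y).
Proof.
move=> dpsi HC x y.
pose c (s : R) : 'cV[R]_d := y + s *: (x - y).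
have dc i s : is_derive s (1 : R) (fun r => c r i ord0) ((x - y) i ord0).
  have -> : (fun r => c r i ord0) = (fun r => y i ord0 + r * (x - y) i ord0).
    by apply/funext => r; rewrite /c 2!mxE.
  apply: (is_derive_eq (is_deriveD (is_derive_cst (y i ord0) s 1)
    (is_deriveM (is_derive_id s 1) (is_derive_cst ((x - y) i ord0) s 1)))).
  by rewrite /GRing.scale/= mulr0 !add0r mulr1.
have diffc i s : differentiable (fun r : R => c r i ord0) s.
  by apply/derivable1_diffP; have [] := dc i s.
pose dh s := \sum_i 'D_(delta_mx i ord0) psi (c s) * (x - y) i ord0.
have hder s : is_derive s (1 : R) (psi \o c) (dh s).
  apply: DeriveDef.
    apply/derivable1_diffP; apply: differentiable_comp => //.
  rewrite derive_comp_cV//; apply: eq_bigr => i _.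
  by have [_ ->] := dc i s.
have [|s _] := @MVT R (psi \o c) dh 0 1 ltr01 (fun s _ => hder s).
  apply: continuous_subspaceT => s; apply: differentiable_continuous.
  by apply/derivable1_diffP; have [] := hder s.
rewrite /= /c scale1r scale0r addr0 (addrC y) subrK subr0 mulr1 => ->.
rewrite mulr_suml; apply: le_trans (ler_norm_sum _ _ _) _.
apply: ler_sum => i _; rewrite normrM; apply: ler_pM => //.
exact: coord_le_enorm.
Qed.

Lemma Cc_infty_differentiable psi x : Cc_infty psi -> differentiable psi x.
Proof. by case=> Cpsi _; have [] := (class_CS _ _).1 (Cpsi 1%N). Qed.

Lemma Cc_infty_continuous psi : Cc_infty psi -> continuous psi.
Proof. by case=> Cpsi _; exact: class_C_continuous (Cpsi 0). Qed.

Lemma Cc_infty_gradient_bound psi : Cc_infty psi ->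
  exists2 C : 'I_d -> R, (forall i, 0 <= C i) &
    forall i x, `|'D_(delta_mx i ord0) psi x| <= C i.
Proof.
move=> Cpsi.
have H i : exists C : R, 0 <= C /\
    forall x, `|'D_(delta_mx i ord0) psi x| <= C.
  have [C C0 HC] := Cc_infty_bounded (Cc_infty_derive (delta_mx i ord0) Cpsi).
  by exists C.
exists (fun i => projT1 (cid (H i))) => i; by case: cid => C [].
Qed.

Lemma Cc_infty_lipschitz psi : Cc_infty psi ->
  exists2 L : R, 0 <= L & forall x y, `|psi x - psi y| <= L * enorm (x - y).
Proof.
move=> Cpsi; have [C C0 HC] := Cc_infty_gradient_bound Cpsi.
exists (\sum_i C i); first exact: sumr_ge0.
apply: bounded_gradient_lipschitz => // x; exact: Cc_infty_differentiable.
Qed.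

(** For a = r the gradient at x is that of psi at x / r: truncations by dilation
    have gradient bounds that do not depend on the radius r.  The choice
    a = r ^ 2 does the same for second derivatives. *)
Definition dilate (a r : R) psi : 'cV[R]_d -> R := fun x => a * psi (r^-1 *: x).

Lemma derive_dilate (a r : R) psi x i : differentiable psi (r^-1 *: x) ->
  'D_(delta_mx i ord0) (dilate a r psi) x =
  a * r^-1 * 'D_(delta_mx i ord0) psi (r^-1 *: x).
Proof.
move=> dpsi; have dl : differentiable (fun z : 'cV[R]_d => r^-1 *: z) x.
  exact: differentiableZ.
have dc : differentiable (psi \o (fun z : 'cV[R]_d => r^-1 *: z)) x.
  exact: differentiable_comp.
have -> : dilate a r psi = a \*: (psi \o (fun z : 'cV[R]_d => r^-1 *: z)) by [].
rewrite deriveZ; last exact: diff_derivable.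
rewrite deriveE// diff_comp//= -(deriveE _ dl) deriveZ// derive_id.
by rewrite linearZ/= -deriveE// /GRing.scale/= mulrA.
Qed.

Lemma Cc_infty_dilate (a r : R) psi : 0 < r -> Cc_infty psi ->
  Cc_infty (dilate a r psi).
Proof.
move=> r0 [Cpsi cK].
have csc : continuous (fun z : 'cV[R]_d => r *: z).
  exact: scaler_continuous.
have cK' : compact ((fun z : 'cV[R]_d => r *: z) @` support_closure psi).
  by apply: continuous_compact => //; exact: continuous_subspaceT.
apply: (Cc_infty_compact cK') => [z|n].
  rewrite /dilate mulf_eq0 negb_or => /andP[_ z0].
  exists (r^-1 *: z); last by rewrite scalerA divff ?scale1r// gt_eqF.
  exact: subset_closure.
apply: class_CM; first exact: class_C_cst.
apply: (@class_C_comp _ _ _ _ psi (fun z : 'cV[R]_d => r^-1 *: z)) => // i.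
apply: (@class_C_ext _ _ _ (fun z : 'cV[R]_d => r^-1 * z i ord0)).
  by move=> z; rewrite mxE.
by apply: class_CM; [exact: class_C_cst|exact: class_C_coord].
Qed.

Definition cutoff : 'cV[R]_d -> R := box_bump 1 (const_mx (- 2)) (const_mx 2).

Lemma cutoff_eq1 x : (forall i, `|x i ord0| <= 1) -> cutoff x = 1.
Proof.
move=> x1; rewrite /cutoff /box_bump big1// => i _; rewrite !mxE !mul1r.
have := x1 i; rewrite ler_norml => /andP[? ?].
by rewrite !step_ge1 ?mulr1//; lra.
Qed.

Lemma Cc_infty_cutoffM (q : 'cV[R]_d -> R) : (forall n, class_C n q) ->
  Cc_infty (fun x => q x * cutoff x).
Proof.
move=> Cq; have [Cc cK] := box_bump_Cc 1 (const_mx (- 2) : 'cV[R]_d) (const_mx 2).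
apply: (Cc_infty_compact cK) => [z|n]; last exact: class_CM.
by rewrite mulf_eq0 negb_or => /andP[_ z0]; exact: subset_closure.
Qed.

Lemma near_scaled_in_unit_box x :
  \forall n \near \oo, forall i, `|(n.+1%:R^-1 *: x) i ord0| < 1.
Proof.
have : \forall n \near \oo, forall i : 'I_d, `|x i ord0| < n%:R.
  by apply: filter_forall => i; exact: nbhs_infty_gtr.
apply: filterS => n H i; rewrite mxE normrM normfV normr_nat.
by rewrite mulrC ltr_pdivrMr// mul1r (lt_trans (H i))// ltr_nat.
Qed.

End Cc_infty_theory.

(** * Averages of Lipschitz functions along a curve of measures *)

Section affine_pairing.
Context {R : realType} {d : nat}.
Implicit Types (x u : 'cV[R]_d).

Definition norm1_mx m n (P : 'M[R]_(m, n)) : R := \sum_i \sum_j `|P i j|.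

Lemma norm1_mx_ge0 m n (P : 'M[R]_(m, n)) : 0 <= norm1_mx P.
Proof. by apply: sumr_ge0 => i _; exact: sumr_ge0. Qed.

Lemma enorm_affine_le (P : 'M[R]_d) x (c : 'cV[R]_d) :
  enorm (P *m x + c) <= norm1_mx P * enorm x + norm1_mx c.
Proof.
apply: le_trans (enorm_le_sum _) _.
rewrite /norm1_mx mulr_suml -big_split/=; apply: ler_sum => i _.
rewrite big_ord1 mxE; apply: le_trans (ler_normD _ _) _; rewrite lerD2r.
rewrite mxE; apply: le_trans (ler_norm_sum _ _ _) _.
rewrite mulr_suml; apply: ler_sum => j _; rewrite normrM ler_wpM2l//.
exact: coord_le_enorm.
Qed.

Lemma enorm_mulmx_le (P : 'M[R]_d) x : enorm (P *m x) <= norm1_mx P * enorm x.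
Proof.
have := enorm_affine_le P x 0; rewrite addr0 => /le_trans; apply.
rewrite /norm1_mx [X in _ + X]big1 ?addr0// => i _.
by rewrite big1// => j _; rewrite mxE normr0.
Qed.

Lemma continuous_affine (P : 'M[R]_d) (c : 'cV[R]_d) :
  continuous (fun x : 'cV[R]_d => P *m x + c).
Proof.
move=> x; apply: continuous_cV => i.
suff C0 : class_C 0 (fun z : 'cV[R]_d => \sum_j P i j * z j ord0 + c i ord0).
  have -> : (fun z => (P *m z + c) i ord0) =
      (fun z : 'cV[R]_d => \sum_j P i j * z j ord0 + c i ord0).
    by apply/funext => z; rewrite !mxE.
  exact: (class_C_continuous C0).
apply: class_CD; last exact: class_C_cst.
by apply: class_C_sum => j; apply: class_CM; [exact: class_C_cst|exact: class_C_coord].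
Qed.

Definition W2_continuous (m : R -> P2 R d) : Prop :=
  forall t : R, W2 (m s) (m t) @[s --> t] --> (0 : R).

Section lipschitz_integrand.
Variables (psi : 'cV[R]_d -> R) (L : R).
Hypothesis psi_cont : continuous psi.
Hypothesis L0 : 0 <= L.
Hypothesis psi_lip : forall x y, `|psi x - psi y| <= L * enorm (x - y).

Lemma measurable_affine_pairing (P : 'M[R]_d) c :
  measurable_fun setT (fun x => psi (P *m x + c)).
Proof.
apply: continuous_measurable_cV => x.
apply: (@continuous_comp _ _ _ (fun x : 'cV[R]_d => P *m x + c) psi).
  exact: continuous_affine.
exact: psi_cont.
Qed.

Lemma integrable_affine_pairing (mu : P2 R d) (P : 'M[R]_d) c :
  mu.-integrable setT (EFin \o (fun x => psi (P *m x + c))).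
Proof.
apply: (@P2_integrable _ _ mu _ (`|psi 0| + L * (norm1_mx P + norm1_mx c))).
  exact: measurable_affine_pairing.
move=> x; rewrite -(subrK (psi 0) (psi _)).
apply: le_trans (ler_normD _ _) _.
apply: (@le_trans _ _ (L * (norm1_mx P * enorm x + norm1_mx c) + `|psi 0|)).
  rewrite lerD2r; apply: le_trans (psi_lip _ _) _.
  by rewrite subr0 ler_wpM2l// enorm_affine_le.
have e1 := enorm_le1Dsqr x; have e0 := enorm_ge0 x.
have P0 := norm1_mx_ge0 P; have c0 := norm1_mx_ge0 c.
have psi0 := normr_ge0 (psi 0).
rewrite addrC mulrDl; apply: lerD.
  by rewrite ler_peMr// lerDl sqr_ge0.
rewrite -mulrA ler_wpM2l// mulrDl; apply: lerD; first by rewrite ler_wpM2l.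
by rewrite ler_peMr// lerDl sqr_ge0.
Qed.

(** The measure is changed first, for a fixed integrand, and then the integrand,
    under the measure nu. *)
Lemma Rintegral_affine_pairing_le (mu nu : P2 R d) (P Q : 'M[R]_d) c e :
  `|\int[mu]_x psi (P *m x + c) - \int[nu]_x psi (Q *m x + e)| <=
  L * norm1_mx P * W2 mu nu
  + L * (norm1_mx (P - Q) * \int[nu]_x enorm x + norm1_mx (c - e)).
Proof.
rewrite -(subrKA (\int[nu]_x psi (P *m x + c))).
apply: le_trans (ler_normD _ _) _; apply: lerD.
  apply: Rintegral_lipschitz_W2.
  - by rewrite mulr_ge0// norm1_mx_ge0.
  - exact: measurable_affine_pairing.
  - move=> x y; apply: le_trans (psi_lip _ _) _; rewrite -mulrA ler_wpM2l//.
    have -> : P *m x + c - (P *m y + c) = P *m (x - y).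
      by rewrite mulmxBr opprD addrACA subrr addr0.
    exact: enorm_mulmx_le.
  - exact: integrable_affine_pairing.
  - exact: integrable_affine_pairing.
have i1 := integrable_affine_pairing nu P c.
have i2 := integrable_affine_pairing nu Q e.
have ie := P2_integrable_enorm nu.
rewrite -RintegralB//.
have i12 : nu.-integrable setT
    (EFin \o (fun x => psi (P *m x + c) - psi (Q *m x + e))).
  have := integrableD_real i1 (integrableZ_real (-1) i2).
  by apply: eq_integrable => // z _; rewrite /= mulN1r.
apply: le_trans (le_normr_Rintegral _ i12) _ => //.
have iu : nu.-integrable setT
    (EFin \o (fun x => norm1_mx (P - Q) * enorm x + norm1_mx (c - e))).
  apply: integrableD_real; first exact: integrableZ_real.
  exact: integrable_cst_prob.
have -> : norm1_mx (P - Q) * \int[nu]_x enorm x + norm1_mx (c - e) =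
    \int[nu]_x (norm1_mx (P - Q) * enorm x + norm1_mx (c - e)).
  rewrite RintegralD// ?RintegralZl ?Rintegral_cst_prob//.
    exact: integrableZ_real.
  exact: integrable_cst_prob.
rewrite -RintegralZl//; apply: le_Rintegral => //.
- exact: integrable_norm.
- exact: integrableZ_real.
- move=> x _; apply: le_trans (psi_lip _ _) _; rewrite ler_wpM2l//.
  have -> : P *m x + c - (Q *m x + e) = (P - Q) *m x + (c - e).
    by rewrite mulmxBl opprD addrACA.
  exact: enorm_affine_le.
Qed.

Lemma continuous_norm1_mx k l (P : R -> 'M[R]_(k, l)) :
  (forall i j, continuous (fun s => P s i j)) ->
  continuous (fun s => norm1_mx (P s)).
Proof.
move=> cP; apply: (@class_C_continuous _ _ 0).
apply: class_C_sum => i; apply: class_C_sum => j s.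
by apply: cvg_norm; exact: cP.
Qed.

Lemma continuous_affine_pairing (m : R -> P2 R d) (P : R -> 'M[R]_d)
    (c : R -> 'cV[R]_d) :
  W2_continuous m -> (forall i j, continuous (fun s => P s i j)) ->
  (forall i, continuous (fun s => c s i ord0)) ->
  continuous (fun s => \int[m s]_x psi (P s *m x + c s)).
Proof.
move=> cm cP cc t.
pose bound s := L * norm1_mx (P s) * W2 (m s) (m t) +
  L * (norm1_mx (P s - P t) * \int[m t]_x enorm x + norm1_mx (c s - c t)).
have bound0 : bound s @[s --> t] --> (0 : R).
  have -> : (0 : R) = L * norm1_mx (P t) * 0 +
      L * (norm1_mx (P t - P t) * \int[m t]_x enorm x + norm1_mx (c t - c t)).
    rewrite !subrr mulr0 add0r.
    have norm10 k l : norm1_mx (0 : 'M[R]_(k, l)) = 0.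
      by rewrite /norm1_mx big1// => i _; rewrite big1// => j _; rewrite mxE normr0.
    by rewrite !norm10 mul0r addr0 mulr0.
  apply: cvgD.
    apply: cvgM; last exact: cm.
    by apply: cvgM; [exact: cvg_cst|exact: continuous_norm1_mx].
  apply: cvgM; first exact: cvg_cst.
  apply: cvgD; [apply: cvgM; last exact: cvg_cst|].
    apply: (@continuous_norm1_mx _ _ (fun s => P s - P t)) => i j s.
    have -> : (fun s => (P s - P t) i j) = (fun s => P s i j - P t i j).
      by apply/funext => z; rewrite !mxE.
    by apply: cvgB; [exact: cP|exact: cvg_cst].
  apply: (@continuous_norm1_mx _ _ (fun s => c s - c t)) => i j s.
  have -> : (fun s => (c s - c t) i j) = (fun s => c s i j - c t i j).
    by apply/funext => z; rewrite !mxE.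
  by rewrite ord1; apply: cvgB; [exact: cc|exact: cvg_cst].
apply/cvgrPdist_le => e e0.
move/cvgrPdist_le : bound0 => /(_ _ e0); apply: filterS => s.
rewrite sub0r normrN => Hs; rewrite distrC.
apply: le_trans (le_trans (Rintegral_affine_pairing_le _ _ _ _ _ _) _) Hs.
exact: ler_norm.
Qed.

End lipschitz_integrand.

Lemma coord_lipschitz i (x y : 'cV[R]_d) :
  `|x i ord0 - y i ord0| <= 1 * enorm (x - y).
Proof. by have := coord_le_enorm (x - y) i; rewrite 2!mxE mul1r. Qed.

End affine_pairing.

(** * Comoving coordinates *)

Section flow_coordinates.
Context {R : realType} {d : nat}.
Variables (A B : 'M[R]_d) (M0 : 'cV[R]_d).
Implicit Types (x y v : 'cV[R]_d) (t : R).

(** The solution of M' = (A + B) M, an equation that the mean of a weak solution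
    satisfies, as [comoving_mean_zero] shows. *)
Definition mean_flow t : 'cV[R]_d := mexp (A + B) t *m M0.

(** The position relative to the expected mean, brought back to time 0 by the
    linear flow.  It is constant along the characteristics of a solution whose
    mean is mean_flow. *)
Definition comoving x t : 'cV[R]_d := mexp (- A) t *m (x - mean_flow t).

Lemma comoving_affine x t :
  comoving x t = mexp (- A) t *m x + - (mexp (- A) t *m mean_flow t).
Proof. by rewrite /comoving mulmxBr. Qed.

Lemma comovingE x t i : comoving x t i ord0 =
  \sum_j mexp (- A) t i j * (x j ord0 - mean_flow t j ord0).
Proof.
rewrite /comoving [LHS]mxE; apply: eq_bigr => j _.
by congr (_ * _); rewrite [LHS]mxE; congr (_ + _); rewrite [LHS]mxE.
Qed.

Lemma mean_flowE t i : mean_flow t i ord0 =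
  \sum_j mexp (A + B) t i j * M0 j ord0.
Proof. by rewrite /mean_flow mxE. Qed.

Lemma comovingK x t : mexp A t *m comoving x t + mean_flow t = x.
Proof. by rewrite /comoving mulmxA mexpKN mul1mx subrK. Qed.

Lemma is_derive_mulmx (P dP : 'M[R]_d) (E : R -> 'M[R]_d) (u : R -> 'cV[R]_d)
    (du : 'cV[R]_d) t i :
  (forall j, is_derive t (1 : R) (fun s => E s i j) (dP i j)) ->
  (forall j, is_derive t (1 : R) (fun s => u s j ord0) (du j ord0)) ->
  is_derive t (1 : R) (fun s => (E s *m u s) i ord0)
    ((dP *m u t + E t *m du) i ord0).
Proof.
move=> dE dU.
have -> : (fun s => (E s *m u s) i ord0) =
    (fun s => \sum_j E s i j * u s j ord0).
  by apply/funext => s; rewrite mxE.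
apply: is_derive_eq.
  by apply: is_derive_sumfun => j; exact: (is_deriveM (dE j) (dU j)).
rewrite 3!mxE -big_split/=; apply: eq_bigr => j _.
by rewrite addrC; congr (_ + _); rewrite mulrC.
Qed.

Lemma is_derive_mean_flow t i :
  is_derive t (1 : R) (fun s => mean_flow s i ord0)
    (((A + B) *m mean_flow t) i ord0).
Proof.
apply: (is_derive_eq (@is_derive_mulmx 0 ((A + B) *m mexp (A + B) t)
  (mexp (A + B)) (fun=> M0) 0 t i (fun j => is_derive_mexpl _ _ _ _) _)).
  by move=> j; rewrite mxE; exact: is_derive_cst.
by rewrite mulmx0 addr0 mulmxA.
Qed.

Lemma is_derive_comoving x t i :
  is_derive t (1 : R) (fun s => comoving x s i ord0)
    ((- (mexp (- A) t *m (A *m x + B *m mean_flow t))) i ord0).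
Proof.
apply: (is_derive_eq (@is_derive_mulmx 0 (mexp (- A) t *m - A) (mexp (- A))
  (fun s => x - mean_flow s) (- ((A + B) *m mean_flow t)) t i
  (fun j => is_derive_mexpr _ _ _ _) _)).
  move=> j.
  have -> : (fun s => (x - mean_flow s) j ord0) =
      (fun s => x j ord0 - mean_flow s j ord0).
    by apply/funext => s; rewrite !mxE.
  apply: (is_derive_eq (is_deriveB (is_derive_cst (x j ord0) t 1)
    (is_derive_mean_flow t j))).
  by rewrite sub0r [RHS]mxE.
rewrite -[in RHS]mulmxN -[in LHS]mulmxA -mulmxDr.
congr ((_ *m _) i ord0).
rewrite mulmxBr mulmxDl !mulNmx opprK !opprD.
by rewrite addrA addrK.
Qed.

Lemma is_derive_comoving_space x t i k :
  is_derive x (delta_mx k ord0) (fun y => comoving y t i ord0)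
    (mexp (- A) t i k).
Proof.
have -> : (fun y => comoving y t i ord0) =
    (fun y => \sum_j mexp (- A) t i j * (y j ord0 - mean_flow t j ord0)).
  by apply/funext => y; exact: comovingE.
have dc j : is_derive x (delta_mx k ord0)
    (fun y : 'cV[R]_d => mexp (- A) t i j * (y j ord0 - mean_flow t j ord0))
    (mexp (- A) t i j * (j == k)%:R).
  have dj : is_derive x (delta_mx k ord0) (fun y : 'cV[R]_d => y j ord0)
      ((j == k)%:R : R).
    have dd : derivable (fun y : 'cV[R]_d => y) x (delta_mx k ord0).
      exact: derivable_id.
    apply: DeriveDef; first exact: ((derivable_mxP _ _ _).1 dd j ord0).
    have := derive_mx dd; rewrite derive_id => /matrixP/(_ j ord0).
    by rewrite !mxE eqxx andbT => <-.
  apply: (is_derive_eq (is_deriveM (is_derive_cst (mexp (- A) t i j) x _)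
    (is_deriveB dj (is_derive_cst (mean_flow t j ord0) x _)))).
  by rewrite /GRing.scale/= subr0 mulr0 addr0.
have -> : mexp (- A) t i k = \sum_j mexp (- A) t i j * (j == k)%:R.
  rewrite (bigD1 k)//= eqxx mulr1 big1 ?addr0// => j /negbTE ->.
  by rewrite mulr0.
have -> : (fun y : 'cV[R]_d =>
    \sum_j mexp (- A) t i j * (y j ord0 - mean_flow t j ord0)) =
    \sum_j (fun y : 'cV[R]_d =>
      mexp (- A) t i j * (y j ord0 - mean_flow t j ord0)).
  by apply/funext => y; rewrite fct_sumE.
exact: is_derive_sum.
Qed.

Lemma class_C_comoving n i :
  class_C n (fun z : 'cV[R]_d * R => comoving z.1 z.2 i ord0).
Proof.
have Ct (s : R -> R) : class_C n s -> class_C n (fun z : 'cV[R]_d * R => s z.2).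
  move=> Cs; apply: (@class_C_comp_real _ _ _ s) => //.
  suff : class_C n (snd : {linear ('cV[R]_d * R)%type -> R}) by [].
  by apply: class_C_linear => z; exact: cvg_snd.
have Cx j : class_C n (fun z : 'cV[R]_d * R => z.1 j ord0).
  have @f : {linear ('cV[R]_d * R)%type -> R}.
    by exists (fun z : 'cV[R]_d * R => z.1 j ord0);
      do 2![eexists]; do ?[constructor];
      rewrite ?mxE// => ? *; rewrite ?mxE//; move=> ?; rewrite !mxE.
  suff : class_C n f by [].
  apply: class_C_linear => z.
  apply: (@continuous_comp _ _ _ fst (fun x : 'cV[R]_d => x j ord0)).
    exact: cvg_fst.
  exact: coord_continuous.
apply: (@class_C_ext _ _ _ (fun z : 'cV[R]_d * R => \sum_j mexp (- A) z.2 i j *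
   (z.1 j ord0 - \sum_k mexp (A + B) z.2 j k * M0 k ord0))).
  by move=> z; rewrite comovingE; apply: eq_bigr => j _; rewrite mean_flowE.
apply: class_C_sum => j; apply: class_CM.
  by apply: (Ct (fun t => mexp (- A) t i j)); exact: class_C_mexp.
apply: class_CB => //; apply: class_C_sum => k; apply: class_CM.
  by apply: (Ct (fun t => mexp (A + B) t j k)); exact: class_C_mexp.
exact: class_C_cst.
Qed.

(** The coordinate comoving x t moves at velocity - exp (- t A) (A x + B N) when x
    is fixed and has space derivative exp (- t A).  Hence a particle at x with
    velocity v only sees the difference between v and A x + B N. *)
Lemma transport_derivative (eta : R -> R) (psi : 'cV[R]_d -> R) x t v :
  derivable eta t 1 -> (forall y, differentiable psi y) ->
  derive1 (fun s => eta s * psi (comoving x s)) t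
    + dot (grad (fun y => eta t * psi (comoving y t)) x) v =
  derive1 eta t * psi (comoving x t)
    + eta t * \sum_i 'D_(delta_mx i ord0) psi (comoving x t)
       * (mexp (- A) t *m (v - (A *m x + B *m mean_flow t))) i ord0.
Proof.
move=> deta dpsi.
have ct i : differentiable (fun s : R => comoving x s i ord0) t.
  by apply/derivable1_diffP; have [] := is_derive_comoving x t i.
have cx i : differentiable (fun y : 'cV[R]_d => comoving y t i ord0) x.
  have -> : (fun y : 'cV[R]_d => comoving y t i ord0) =
     (fun y => \sum_j mexp (- A) t i j * (y j ord0 - mean_flow t j ord0)).
    by apply/funext => y; exact: comovingE.
  have : class_C 1 (fun y : 'cV[R]_d =>
      \sum_j mexp (- A) t i j * (y j ord0 - mean_flow t j ord0)).
    apply: class_C_sum => j; apply: class_CM; first exact: class_C_cst.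
    by apply: class_CB; [exact: class_C_coord|exact: class_C_cst].
  by move=> /class_CS[].
have dpt : derivable (fun s : R => psi (comoving x s)) t 1.
  apply/derivable1_diffP.
  apply: (@differentiable_comp _ _ _ _ (comoving x) psi) => //.
  exact: differentiable_cV.
have -> : derive1 (fun s => eta s * psi (comoving x s)) t =
    derive1 eta t * psi (comoving x t) + eta t *
    \sum_i 'D_(delta_mx i ord0) psi (comoving x t)
      * (- (mexp (- A) t *m (A *m x + B *m mean_flow t))) i ord0.
  rewrite derive1E (deriveM deta dpt) derive1E addrC /GRing.scale/=.
  rewrite mulrC; congr (_ + _ * _).
  rewrite (derive_comp_cV (psi := psi) (y := comoving x))//.
  by apply: eq_bigr => i _; have [_ ->] := is_derive_comoving x t i.
have gradE k : grad (fun y => eta t * psi (comoving y t)) x k ord0 =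
    eta t * \sum_i 'D_(delta_mx i ord0) psi (comoving x t) * mexp (- A) t i k.
  rewrite mxE.
  have dpx : derivable (fun y => psi (comoving y t)) x (delta_mx k ord0).
    apply: diff_derivable.
    apply: (@differentiable_comp _ _ _ _ (comoving^~ t) psi) => //.
    exact: differentiable_cV.
  rewrite deriveMl// /GRing.scale/=; congr (_ * _).
  rewrite (derive_comp_cV (psi := psi) (y := comoving^~ t))//.
  by apply: eq_bigr => i _; have [_ ->] := is_derive_comoving_space x t i k.
have -> : dot (grad (fun y => eta t * psi (comoving y t)) x) v = eta t *
    \sum_i 'D_(delta_mx i ord0) psi (comoving x t)
      * (mexp (- A) t *m v) i ord0.
  rewrite dotE mulr_sumr.
  under eq_bigr do rewrite gradE -mulrA mulr_suml mulr_sumr.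
  rewrite exchange_big/=; apply: eq_bigr => i _.
  rewrite -mulr_sumr; congr (_ * _); rewrite [in RHS]mxE mulr_sumr.
  by apply: eq_bigr => k _; rewrite mulrA.
rewrite -addrA -mulrDr; congr (_ + _ * _).
rewrite -big_split/=; apply: eq_bigr => i _.
rewrite -mulrDr; congr (_ * _).
by rewrite mulmxBr addrC [RHS]mxE.
Qed.

Definition space_time_test (eta : R -> R) (psi : 'cV[R]_d -> R)
  : 'cV[R]_d * R -> R := fun z => eta z.2 * psi (comoving z.1 z.2).

(** The inverse change of coordinates is continuous in (y, t), so the support is
    contained in the image of a compact product. *)
Lemma test_function_comoving (eta : R -> R) (psi : 'cV[R]_d -> R) (T : R) :
  Cc_infty eta -> support_closure eta `<=` [set t | 0 < t < T] ->
  Cc_infty psi -> test_function T (space_time_test eta psi).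
Proof.
move=> [Ceta cKeta] supp [Cpsi cKpsi].
pose Phi (z : 'cV[R]_d * R) := (mexp A z.2 *m z.1 + mean_flow z.2, z.2).
pose K := Phi @` (support_closure psi `*` support_closure eta).
have cPhi : continuous Phi.
  move=> z.
  suff c1 : {for z, continuous (fun z : 'cV[R]_d * R =>
      mexp A z.2 *m z.1 + mean_flow z.2)}.
    exact: (cvg_pair c1 cvg_snd).
  apply: continuous_cV => i.
  suff C0 : class_C 0 (fun z : 'cV[R]_d * R =>
      (mexp A z.2 *m z.1 + mean_flow z.2) i ord0).
    exact: (class_C_continuous C0).
  have Ct (s : R -> R) : class_C 0 s -> class_C 0 (fun z : 'cV[R]_d * R => s z.2).
    move=> Cs; apply: (@class_C_comp_real _ _ _ s) => //.
    suff : class_C 0 (snd : {linear ('cV[R]_d * R)%type -> R}) by [].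
    by apply: class_C_linear => u; exact: cvg_snd.
  apply: (@class_C_ext _ _ _ (fun z : 'cV[R]_d * R =>
     \sum_j mexp A z.2 i j * z.1 j ord0
     + \sum_k mexp (A + B) z.2 i k * M0 k ord0)).
    by move=> u; rewrite !mxE.
  apply: class_CD; apply: class_C_sum => j; apply: class_CM.
  - by apply: (Ct (fun t => mexp A t i j)); exact: class_C_mexp.
  - move=> u; apply: (@continuous_comp _ _ _ fst (fun x : 'cV[R]_d => x j ord0)).
      exact: cvg_fst.
    exact: coord_continuous.
  - by apply: (Ct (fun t => mexp (A + B) t i j)); exact: class_C_mexp.
  - exact: class_C_cst.
have cK : compact K.
  apply: continuous_compact; first exact: continuous_subspaceT.
  exact: compact_setX.
have inK z : space_time_test eta psi z != 0 -> K z.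
  rewrite /space_time_test mulf_eq0 negb_or => /andP[z2 z1].
  exists (comoving z.1 z.2, z.2).
    by split; exact: subset_closure.
  by rewrite /Phi/= comovingK -surjective_pairing.
split.
  apply: (Cc_infty_compact cK) => // n; apply: class_CM.
    apply: (@class_C_comp_real _ _ _ eta) => //.
    suff : class_C n (snd : {linear ('cV[R]_d * R)%type -> R}) by [].
    by apply: class_C_linear => u; exact: cvg_snd.
  apply: (@class_C_comp _ _ _ _ psi
    (fun z : 'cV[R]_d * R => comoving z.1 z.2)) => // i.
  exact: class_C_comoving.
have clK : closed K by apply: compact_closed => //; exact: norm_hausdorff.
apply: (@subset_trans _ K).
  rewrite [X in _ `<=` X](closure_id _).1//.
  by apply: closure_subset => z; exact: inK.
by move=> _ [[y t] /= [_ /supp tT] <-].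
Qed.

End flow_coordinates.

(** * Weak solutions are transported by an affine flow *)

Section weak_solutions.
Context {R : realType} {d : nat}.
Notation leb := (@lebesgue_measure R).

Definition mean (mu : P2 R d) : 'cV[R]_d := vint mu id.

Lemma meanE (mu : P2 R d) i : mean mu i ord0 = \int[mu]_x x i ord0.
Proof. by rewrite mxE. Qed.

Lemma Rintegral_mulmx (mu : P2 R d) (P : 'M[R]_d) i :
  \int[mu]_x (P *m x) i ord0 = (P *m mean mu) i ord0.
Proof.
under eq_Rintegral do rewrite mxE.
rewrite Rintegral_sum_real => [|j]; last first.
  exact: integrableZ_real (P2_integrable_coord mu j).
rewrite mxE; apply: eq_bigr => j _; rewrite RintegralZl ?meanE//.
exact: P2_integrable_coord.
Qed.

Lemma vint_mulmx (mu : P2 R d) (P : 'M[R]_d) :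
  vint mu (fun y => P *m y) = P *m mean mu.
Proof.
by apply/matrixP => i j; rewrite ord1 [LHS]mxE Rintegral_mulmx.
Qed.

Lemma continuous_mulmx k l n (P : R -> 'M[R]_(k, l)) (Q : R -> 'M[R]_(l, n)) :
  (forall i j, continuous (fun s => P s i j)) ->
  (forall i j, continuous (fun s => Q s i j)) ->
  forall i j, continuous (fun s => (P s *m Q s) i j).
Proof.
move=> cP cQ i j.
have -> : (fun s => (P s *m Q s) i j) = (fun s => \sum_r P s i r * Q s r j).
  by apply/funext => s; rewrite mxE.
apply: (@class_C_continuous _ _ 0); apply: class_C_sum => r.
by apply: class_CM; [exact: cP|exact: cQ].
Qed.

Lemma continuous_bounded_itv (f : R -> R) (T : R) : continuous f -> 0 <= T ->
  exists2 C : R, 0 <= C & forall t, 0 <= t <= T -> `|f t| <= C.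
Proof.
move=> cf T0.
have cn : {within `[0, T], continuous (fun t => `|f t|)}.
  by apply: continuous_subspaceT => t; apply: cvg_norm; exact: cf.
have [r rT Hr] := EVT_max T0 cn.
exists `|f r| => // t tT; apply: Hr; by rewrite in_itv.
Qed.

Lemma continuous_mexp (A : 'M[R]_d) i j : continuous (fun t => mexp A t i j).
Proof. exact: class_C_continuous (class_C_mexp 0 A i j). Qed.

Section one_solution.
Variables (A B : 'M[R]_d) (f : 'cV[R]_d -> P2 R d -> 'cV[R]_d).
Hypothesis f_def : forall x m, f x m = A *m x + vint m (fun y => B *m y).
Variable m : R -> P2 R d.
Hypothesis sol_m : solution f m.

(* Extending m by m 0 to negative times makes it continuous on the whole
   line. *)
Let mc (t : R) := m (Num.max 0 t).
Let M0 := mean (m 0).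
Let N := mean_flow A B M0.
Let Y := comoving A B M0.

Lemma solution_W2_continuous : W2_continuous mc.
Proof.
move=> t; have T0 : 0 < `|t| + 1 by rewrite ltr_wpDl.
have [cm _] := sol_m T0.
have inT s : `|s| <= `|t| + 1 -> Num.max 0 s \in `[0, `|t| + 1].
  move=> st; rewrite in_itv/= le_max lexx/= ge_max (ltW T0)/=.
  exact: le_trans (ler_norm _) st.
have tT : Num.max 0 t \in `[0, `|t| + 1] by apply: inT; rewrite lerDl.
have := cm _ tT.
move/cvgrPdist_lt => H; apply/cvgrPdist_lt => e e0.
have := H e e0; rewrite near_withinE => He.
have cmax : continuous (fun s : R => Num.max 0 s).
  move=> s; apply: continuous_max; [exact: cvg_cst|exact: cvg_id].
have := cmax t _ He.
have nearT : \forall s \near t, `|s| <= `|t| + 1.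
  apply/nbhs_ballP; exists 1 => //= s /ltW ts; rewrite -lerBlDl.
  by apply: le_trans ts; rewrite distrC; apply: le_trans (lerB_dist _ _) _.
apply: filterS2 nearT => s sT /= Hs; apply: Hs; exact: inT.
Qed.

Let g (psi : 'cV[R]_d -> R) (t : R) := \int[mc t]_x psi (Y x t).

Lemma continuous_moving_average (psi : 'cV[R]_d -> R) (L : R) :
  continuous psi -> 0 <= L ->
  (forall x y, `|psi x - psi y| <= L * enorm (x - y)) -> continuous (g psi).
Proof.
move=> cpsi L0 psiL.
have -> : g psi = (fun s => \int[mc s]_x
    psi (mexp (- A) s *m x + - (mexp (- A) s *m N s))).
  by apply/funext => s; apply: eq_Rintegral => x _; rewrite /Y comoving_affine.
apply: (continuous_affine_pairing cpsi L0 psiL).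
- exact: solution_W2_continuous.
- exact: continuous_mexp.
- move=> i t.
  have -> : (fun s => (- (mexp (- A) s *m N s)) i ord0) =
      (fun s => - (mexp (- A) s *m N s) i ord0).
    by apply/funext => s; rewrite mxE.
  apply: cvgN; apply: continuous_mulmx => [k l|k l]; first exact: continuous_mexp.
  apply: continuous_mulmx => [k' l'|k' l' u]; first exact: continuous_mexp.
  exact: cvg_cst.
Qed.

Lemma integrable_moving (psi : 'cV[R]_d -> R) (L t : R) :
  continuous psi -> 0 <= L ->
  (forall x y, `|psi x - psi y| <= L * enorm (x - y)) ->
  (mc t).-integrable setT (EFin \o (fun x => psi (Y x t))).
Proof.
move=> cpsi L0 psiL.
have -> : (fun x => psi (Y x t)) =
    (fun x => psi (mexp (- A) t *m x + - (mexp (- A) t *m N t))).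
  by apply/funext => x; rewrite /Y comoving_affine.
exact: (integrable_affine_pairing cpsi L0 psiL).
Qed.

Lemma Cc_continuous_moving_average (psi : 'cV[R]_d -> R) :
  Cc_infty psi -> continuous (g psi).
Proof.
move=> Cpsi; have [L L0 psiL] := Cc_infty_lipschitz Cpsi.
exact: continuous_moving_average (Cc_infty_continuous Cpsi) L0 psiL.
Qed.

Lemma Cc_integrable_moving (psi : 'cV[R]_d -> R) (t : R) : Cc_infty psi ->
  (mc t).-integrable setT (EFin \o (fun x => psi (Y x t))).
Proof.
move=> Cpsi; have [L L0 psiL] := Cc_infty_lipschitz Cpsi.
exact: integrable_moving (Cc_infty_continuous Cpsi) L0 psiL.
Qed.

(* The error on the mean, in comoving coordinates; Q is B in these
   coordinates. *)
Let w (t : R) : 'cV[R]_d := mexp (- A) t *m (mean (mc t) - N t).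
Let Q (t : R) : 'M[R]_d := mexp (- A) t *m B *m mexp A t.

Lemma moving_coordE i t : g (fun y => y i ord0) t = w t i ord0.
Proof.
rewrite /g /w mulmxBr [RHS]mxE -Rintegral_mulmx.
under eq_Rintegral do rewrite /Y comoving_affine mxE.
rewrite RintegralD ?Rintegral_cst_prob//; last exact: integrable_cst_prob.
have := @integrable_affine_pairing R d _ 1 (@coord_cV_continuous R d i) ler01
  (coord_lipschitz i) (mc t) (mexp (- A) t) 0.
by apply: eq_integrable => // x _; rewrite /= addr0.
Qed.

Lemma continuous_w i : continuous (fun t => w t i ord0).
Proof.
under eq_fun do rewrite -moving_coordE.
exact: continuous_moving_average (@coord_cV_continuous R d i) ler01
  (coord_lipschitz i).
Qed.

Lemma QwE t : Q t *m w t = mexp (- A) t *m (B *m (mean (mc t) - N t)).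
Proof. by rewrite /Q /w -!mulmxA (mulmxA (mexp A t)) mexpKN mul1mx. Qed.

(* The weak derivative of g psi. *)
Let k (psi : 'cV[R]_d -> R) (t : R) :=
  \sum_i g ('D_(delta_mx i ord0) psi) t * (Q t *m w t) i ord0.

Lemma continuous_k (psi : 'cV[R]_d -> R) : Cc_infty psi -> continuous (k psi).
Proof.
move=> Cpsi; apply: (@class_C_continuous _ _ 0); apply: class_C_sum => i.
apply: class_CM; first exact/Cc_continuous_moving_average/Cc_infty_derive.
apply: continuous_mulmx => [a b|a b]; last by rewrite ord1; exact: continuous_w.
apply: continuous_mulmx => [a' b'|]; last exact: continuous_mexp.
apply: continuous_mulmx => [|a'' b'' u]; first exact: continuous_mexp.
exact: cvg_cst.
Qed.

(** The velocity at x is A x + B (mean of m t), so the discrepancy of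
    [transport_derivative] does not depend on x: it is B applied to the error
    made on the mean.  The weak equation tested with eta (t) psi (comoving x t)
    becomes a weak equation in time for the average of psi. *)
Lemma weak_moving_average (psi : 'cV[R]_d -> R) (eta : R -> R) (T : R) :
  0 < T -> Cc_infty psi -> Cc_infty eta ->
  support_closure eta `<=` [set t | 0 < t < T] ->
  \int[leb]_(t in `[0, T]) (derive1 eta t * g psi t + eta t * k psi t) = 0.
Proof.
move=> T0 Cpsi Ceta supp.
have [_ weak] := sol_m T0.
rewrite -[RHS](weak _ (test_function_comoving A B M0 Ceta supp Cpsi)).
apply: eq_Rintegral => t; rewrite inE/= in_itv/= => /andP[t0 tT].
have mct : mc t = m t by rewrite /mc max_r.
have deta : derivable eta t 1.
  by apply/derivable1_diffP; case: Ceta => Ceta _;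
    have [] := (class_CS _ _).1 (Ceta 1%N).
have dpsi y : differentiable psi y by exact: Cc_infty_differentiable.
have fE x : f x (m t) = A *m x + B *m mean (mc t) by rewrite f_def vint_mulmx mct.
rewrite -mct; transitivity (\int[mc t]_x (derive1 eta t * psi (Y x t)
    + eta t * \sum_i 'D_(delta_mx i ord0) psi (Y x t) * (Q t *m w t) i ord0)).
  have ip := Cc_integrable_moving t Cpsi.
  have iD i := Cc_integrable_moving t (Cc_infty_derive (delta_mx i ord0) Cpsi).
  have iS : (mc t).-integrable setT (EFin \o (fun x =>
      \sum_i 'D_(delta_mx i ord0) psi (Y x t) * (Q t *m w t) i ord0)).
    apply: integrable_sum_real => i; have := integrableZ_real ((Q t *m w t) i ord0) (iD i).
    by apply: eq_integrable => // x _; rewrite /= mulrC.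
  rewrite RintegralD//; [|exact: integrableZ_real|exact: integrableZ_real].
  rewrite RintegralZl// RintegralZl//; congr (_ + _ * _).
  rewrite Rintegral_sum_real => [|i]; last first.
    have := integrableZ_real ((Q t *m w t) i ord0) (iD i).
    by apply: eq_integrable => // x _; rewrite /= mulrC.
  by apply: eq_bigr => i _; rewrite RintegralZr//.
apply: eq_Rintegral => x _.
rewrite mct (@transport_derivative R d A B M0 eta psi x t (f x (m t)) deta dpsi).
congr (_ + _ * _); apply: eq_bigr => i _; congr (_ * _ i ord0).
rewrite QwE fE; congr (_ *m _).
by rewrite opprD addrACA subrr add0r mulmxBr.
Qed.

Lemma w0 : w 0 = 0.
Proof.
by rewrite /w /mc max_l// /N /mean_flow !mexp0 !mul1mx subrr.
Qed.

(** The weak derivative k of the average is bounded by the gradient of psi times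
    the error on the mean. *)
Lemma moving_average_increment (psi : 'cV[R]_d -> R) (T C S : R) (Cg : 'I_d -> R) (s t : R) :
  Cc_infty psi -> 0 <= s -> s < t -> t < T ->
  (forall i y, `|'D_(delta_mx i ord0) psi y| <= Cg i) ->
  (forall r, 0 <= r <= T -> norm1_mx (Q r) <= C) ->
  (forall r, s <= r <= t -> \sum_i `|w r i ord0| <= S) ->
  `|g psi t - g psi s| <= (\sum_i Cg i) * (C * S) * (t - s).
Proof.
move=> Cpsi s0 st tT HC HQ HS.
have T0 : 0 < T by apply: le_lt_trans s0 (lt_trans st tT).
apply: (@weak_derivative_increment R (g psi) (k psi) T s t) => //.
- exact: Cc_continuous_moving_average.
- exact: continuous_k.
- move=> r /andP[sr rt]; rewrite /k mulr_suml.
  apply: le_trans (ler_norm_sum _ _ _) _; apply: ler_sum => i _.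
  have iD := Cc_integrable_moving r (Cc_infty_derive (delta_mx i ord0) Cpsi).
  rewrite normrM; apply: ler_pM => //.
    apply: le_trans (le_normr_Rintegral _ iD) _ => //.
    rewrite -[leRHS](Rintegral_cst_prob (mc r)); apply: le_Rintegral => //.
      exact: integrable_norm.
    exact: integrable_cst_prob.
  apply: (@le_trans _ _ (norm1_mx (Q r) * \sum_j `|w r j ord0|)).
    rewrite [X in `|X|]mxE; apply: le_trans (ler_norm_sum _ _ _) _.
    rewrite /norm1_mx mulr_suml [leRHS](bigD1 i)//= -[leLHS]addr0; apply: lerD.
      rewrite mulr_suml; apply: ler_sum => j _; rewrite normrM ler_wpM2l//.
      by rewrite [leRHS](bigD1 j)//= lerDl; exact: sumr_ge0.
    apply: sumr_ge0 => a _; apply: mulr_ge0; first exact: sumr_ge0.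
    exact: sumr_ge0.
  apply: ler_pM => //.
  - exact: norm1_mx_ge0.
  - exact: sumr_ge0.
  - by apply: HQ; rewrite (le_trans s0 sr) (le_trans rt (ltW tT)).
  - by apply: HS; rewrite sr.
- by move=> eta Ceta supp; exact: weak_moving_average.
Qed.

Lemma continuous_Q i j : continuous (fun t => Q t i j).
Proof.
apply: continuous_mulmx => [a' b'|]; last exact: continuous_mexp.
apply: continuous_mulmx => [|a'' b'' u]; first exact: continuous_mexp.
exact: cvg_cst.
Qed.

(** The coordinates are not compactly supported; their dilated truncations are
    test functions with uniformly bounded gradients that converge to them. *)
Definition truncated_coord i : 'cV[R]_d -> R := fun y => y i ord0 * cutoff y.

Lemma Cc_infty_truncated_coord i : Cc_infty (truncated_coord i).
Proof. by apply: Cc_infty_cutoffM => n; exact: class_C_coord. Qed.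

Lemma cvg_dilate_truncated_coord i y :
  dilate n.+1%:R n.+1%:R (truncated_coord i) y @[n --> \oo] --> y i ord0.
Proof.
apply: cvg_near_cst; have := near_scaled_in_unit_box y.
apply: filterS => n H; rewrite /dilate /truncated_coord cutoff_eq1; last first.
  by move=> j; exact: ltW.
by rewrite mulr1 mxE mulrA divff ?mul1r// pnatr_eq0.
Qed.

Lemma truncated_coord_average i t :
  g (dilate n.+1%:R n.+1%:R (truncated_coord i)) t @[n --> \oo] --> w t i ord0.
Proof.
have [L L0 HL] := Cc_infty_lipschitz (Cc_infty_truncated_coord i).
rewrite -moving_coordE.
apply: (@cvg_Rintegral _ _ _ _ _ _ (fun x => L * enorm (Y x t))).
- move=> n; have Cd : Cc_infty (dilate n.+1%:R n.+1%:R (truncated_coord i)).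
    by apply: Cc_infty_dilate => //; exact: Cc_infty_truncated_coord.
  have := Cc_integrable_moving t Cd.
  by case/integrableP => /measurable_EFinP.
- have := integrable_moving t (@coord_cV_continuous R d i) ler01
    (coord_lipschitz i).
  by case/integrableP => /measurable_EFinP.
- by move=> x; exact: cvg_dilate_truncated_coord.
- apply: integrableZ_real.
  apply: (@P2_integrable _ _ (mc t) _
      (norm1_mx (mexp (- A) t) + norm1_mx (- (mexp (- A) t *m N t)))).
    apply: measurable_enorm => j.
    have := integrable_moving t (@coord_cV_continuous R d j) ler01
      (coord_lipschitz j).
    by case/integrableP => /measurable_EFinP.
  move=> x; rewrite ger0_norm ?enorm_ge0// /Y comoving_affine.
  apply: le_trans (enorm_affine_le _ _ _) _; rewrite mulrDl; apply: lerD.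
    by rewrite ler_wpM2l ?norm1_mx_ge0// enorm_le1Dsqr.
  by rewrite ler_peMr ?norm1_mx_ge0// lerDl sqr_ge0.
- move=> n x; rewrite /dilate normrM normr_nat.
  have tc0 : truncated_coord i 0 = 0 by rewrite /truncated_coord mxE mul0r.
  have := HL (n.+1%:R^-1 *: Y x t) 0; rewrite tc0 !subr0 => H.
  rewrite -ler_pdivlMl//; apply: le_trans H _.
  have -> : enorm (n.+1%:R^-1 *: Y x t) = n.+1%:R^-1 * enorm (Y x t).
    rewrite /enorm dotZl dotZr mulrA -expr2 sqrtrM ?sqr_ge0// sqrtr_sqr.
    by rewrite ger0_norm.
  by rewrite mulrCA.
Qed.

Lemma derive_dilate_bound i j n (C : R) :
  (forall y, `|'D_(delta_mx j ord0) (truncated_coord i) y| <= C) ->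
  forall y, `|'D_(delta_mx j ord0)
    (dilate n.+1%:R n.+1%:R (truncated_coord i)) y| <= C.
Proof.
move=> HC y; rewrite derive_dilate; last first.
  exact/Cc_infty_differentiable/Cc_infty_truncated_coord.
by rewrite divff ?pnatr_eq0// mul1r.
Qed.

(** Tested with truncated coordinates, the error w on the mean satisfies
    |w t - w s| <= C (t - s) sup |w| with w 0 = 0: the constant is uniform in the
    truncation, which is removed at the fixed times s and t only.  Gronwall's
    argument concludes. *)
Lemma comoving_mean_zero (t : R) : 0 <= t -> w t = 0.
Proof.
move=> t0; pose T := t + 1.
have T0 : 0 <= T by rewrite addr_ge0.
have [CQ CQ0 HQ] := continuous_bounded_itv (continuous_norm1_mx continuous_Q) T0.
have HQ' r : 0 <= r <= T -> norm1_mx (Q r) <= CQ.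
  by move=> /HQ; rewrite ger0_norm// norm1_mx_ge0.
have HG i : exists Cg : 'I_d -> R, (forall j, 0 <= Cg j) /\
    forall j x, `|'D_(delta_mx j ord0) (truncated_coord i) x| <= Cg j.
  have [Cg Cg0 HCg] := Cc_infty_gradient_bound (Cc_infty_truncated_coord i).
  by exists Cg.
pose Cg i := projT1 (cid (HG i)).
have Cg0 i j : 0 <= Cg i j by rewrite /Cg; case: cid => ? [].
have HCg i j x : `|'D_(delta_mx j ord0) (truncated_coord i) x| <= Cg i j.
  by rewrite /Cg; case: cid => ? [].
pose W t := \sum_i `|w t i ord0|.
have cW : continuous W.
  apply: (@class_C_continuous _ _ 0); apply: class_C_sum => i u.
  by apply: cvg_norm; exact: continuous_w.
have Wt : W t = 0.
  apply: (@gronwall_zero R W ((\sum_i \sum_j Cg i j) * CQ) T) => //.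
  - by move=> u; exact: sumr_ge0.
  - by rewrite /W w0 big1// => i _; rewrite mxE normr0.
  - by apply: mulr_ge0 => //; apply: sumr_ge0 => i _; exact: sumr_ge0.
  - move=> s u S s0 su uT HS.
    rewrite -lerBlDl -sumrB.
    have -> : (\sum_i \sum_j Cg i j) * CQ * (u - s) * S =
        \sum_i (\sum_j Cg i j) * (CQ * S) * (u - s).
      rewrite -!mulr_suml; ring.
    apply: ler_sum => i _; apply: le_trans (lerB_dist _ _) _.
    have cu : `|g (dilate n.+1%:R n.+1%:R (truncated_coord i)) u
         - g (dilate n.+1%:R n.+1%:R (truncated_coord i)) s| @[n --> \oo]
         --> `|w u i ord0 - w s i ord0|.
      by apply: cvg_norm; apply: cvgB; exact: truncated_coord_average.
    rewrite -(cvg_lim _ cu)//; apply: limr_le.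
      by apply/cvg_ex; eexists; exact: cu.
    apply: nearW => n.
    apply: (@moving_average_increment _ T CQ S) => //.
      by apply: Cc_infty_dilate => //; exact: Cc_infty_truncated_coord.
    by move=> j y; apply: derive_dilate_bound => {}y; exact: HCg.
  - by apply/andP; split => //; rewrite /T ltrDl.
apply/matrixP => i j; rewrite ord1 [RHS]mxE; apply/eqP; rewrite -normr_le0.
by rewrite -Wt /W (bigD1 i)//= lerDl; exact: sumr_ge0.
Qed.

(** Now that the error on the mean vanishes, so does the weak derivative of the
    average. *)
Lemma moving_average_constant (psi : 'cV[R]_d -> R) (t : R) : 0 <= t -> Cc_infty psi ->
  g psi t = g psi 0.
Proof.
rewrite le_eqVlt => /predU1P[<-//|t0] Cpsi.
have Tt : t < t + 1 by rewrite ltrDl.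
have [Cg Cg0 HCg] := Cc_infty_gradient_bound Cpsi.
have [CQ CQ0 HQ] := continuous_bounded_itv (continuous_norm1_mx continuous_Q)
  (ltW (lt_trans t0 Tt)).
have := @moving_average_increment psi (t + 1) CQ 0 Cg 0 t Cpsi (lexx 0) t0 Tt HCg.
rewrite !mulr0 mul0r => H; apply/eqP; rewrite -subr_eq0 -normr_le0; apply: H.
  by move=> r /HQ; rewrite ger0_norm// norm1_mx_ge0.
move=> r /andP[r0 _]; rewrite comoving_mean_zero// big1// => i _.
by rewrite mxE normr0.
Qed.

Lemma comoving_continuous t : continuous (Y^~ t).
Proof.
have -> : Y^~ t = (fun x => mexp (- A) t *m x + - (mexp (- A) t *m N t)).
  by apply/funext => x; rewrite /Y comoving_affine.
exact: continuous_affine.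
Qed.

Definition solution_flow (t : R) (x : 'cV[R]_d) : 'cV[R]_d :=
  mexp A t *m (x - M0) + mexp (A + B) t *m M0.

Lemma solution_flow_continuous t : continuous (solution_flow t).
Proof.
have -> : solution_flow t = (fun x => mexp A t *m x +
    (mexp (A + B) t *m M0 - mexp A t *m M0)).
  by apply/funext => x; rewrite /solution_flow mulmxBr addrAC -addrA.
exact: continuous_affine.
Qed.

(** The law of the comoving coordinate does not depend on time, since its
    integrals against test functions do not; composing with the inverse change
    of coordinates gives the law of m t. *)
Lemma solution_law (t : R) : 0 <= t -> forall S, measurable S ->
  m 0 (solution_flow t @^-1` S) = m t S.
Proof.
move=> t0 S mS.
have mY u : measurable_fun setT (Y^~ u).
  by apply: continuous_measurable_cVcV; exact: comoving_continuous.
pose mYm u : {mfun _ >-> _} := HB.pack (Y^~ u) (isMeasurableFun.Build _ _ _ _ _ (mY u)).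
have law u (E : set _) : measurable E -> mc u (Y^~ u @^-1` E) =
    distribution (mc u) (mYm u) E by [].
have same E : measurable E ->
    distribution (mc t) (mYm t) E = distribution (mc 0) (mYm 0) E.
  apply: Cc_infty_measure_unique => psi Cpsi.
  have int_psi u : (distribution (mc u) (mYm u)).-integrable setT (EFin \o psi).
    have [C C0 HC] := Cc_infty_bounded Cpsi.
    apply: (@integrable_bounded_prob _ _ R (distribution (mc u) (mYm u)) psi C) => //.
    by apply: continuous_measurable_cV; exact: Cc_infty_continuous.
  rewrite -(Rintegral_law (mY t) (law t) (int_psi t)).
  rewrite -(Rintegral_law (mY 0) (law 0) (int_psi 0)).
  exact: moving_average_constant.
pose E := (fun y => mexp A t *m y + N t) @^-1` S.
have mE : measurable E.
  have := continuous_measurable_cVcV (@continuous_affine R d (mexp A t) (N t)).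
  by move=> /(_ measurableT _ mS); rewrite setTI.
have := same E mE; rewrite /distribution /pushforward/=.
have -> : Y^~ t @^-1` E = S.
  apply/seteqP; split=> x; rewrite /E /= ?/Y comovingK//.
have -> : Y^~ 0 @^-1` E = solution_flow t @^-1` S.
  by apply/seteqP; split=> x; rewrite /E /solution_flow/= /Y /comoving /mean_flow
    !mexp0 !mul1mx.
have -> : mc t = m t by rewrite /mc max_r.
by have -> : mc 0 = m 0 by rewrite /mc maxxx.
Qed.

End one_solution.

End weak_solutions.

(** * Affine fields in the tangent space *)

Section tangent_fields.
Context {R : realType} {d : nat}.
Implicit Types (mu : P2 R d) (x k c : 'cV[R]_d).

Lemma L2normE mu (g : 'cV[R]_d -> 'cV[R]_d) :
  mu.-integrable setT (EFin \o (fun x => enorm (g x) ^+ 2)) ->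
  L2norm mu g = (Num.sqrt (\int[mu]_x (enorm (g x) ^+ 2)))%:E.
Proof.
move=> ig; rewrite /L2norm unlock.
have -> : (\int[mu]_x (`|(enorm (g x))%:E| `^ 2) =
    (\int[mu]_x (enorm (g x) ^+ 2))%:E)%E.
  rewrite fineK; last exact: integrable_fin_num ig.
  apply: eq_integral => x _.
  by rewrite /= ger0_norm ?enorm_ge0// powR_mulrn ?enorm_ge0.
rewrite poweR12_sqrt// lee_fin; apply: Rintegral_ge0 => x _.
exact: sqr_ge0.
Qed.

(** Dominated convergence: the squared distance is dominated by a multiple of
    1 + |x| ^ 2, which has a finite integral. *)
Lemma Tan_of_gradients mu (xi : 'cV[R]_d -> 'cV[R]_d)
    (phi : nat -> 'cV[R]_d -> R) (C : R) :
  continuous xi -> (forall n, Cc_infty (phi n)) ->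
  (forall x, \forall n \near \oo, grad (phi n) x = xi x) ->
  (forall n x, enorm (grad (phi n) x) <= C * (1 + enorm x)) ->
  Tan mu xi.
Proof.
move=> cxi Cphi grad_near gradC.
have C0 : 0 <= C.
  have := le_trans (enorm_ge0 _) (gradC 0%N 0).
  have -> : enorm (0 : 'cV[R]_d) = 0.
    by rewrite /enorm dotr0 sqrtr0.
  by rewrite addr0 mulr1.
have xiC x : enorm (xi x) <= C * (1 + enorm x).
  by have [n _ /(_ n (leqnn n)) <-] := grad_near x.
have mxi i : measurable_fun setT (fun x => xi x i ord0).
  apply: continuous_measurable_cV => x.
  apply: (@continuous_comp _ _ _ xi (fun x : 'cV[R]_d => x i ord0)).
    exact: cxi.
  exact: coord_continuous.
have mgrad n i : measurable_fun setT (fun x => grad (phi n) x i ord0).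
  apply: continuous_measurable_cV.
  have -> : (fun x => grad (phi n) x i ord0) = 'D_(delta_mx i ord0) (phi n).
    by apply/funext => x; rewrite mxE.
  exact: Cc_infty_continuous (Cc_infty_derive _ (Cphi n)).
have mB n i : measurable_fun setT (fun x => (xi x - grad (phi n) x) i ord0).
  have -> : (fun x => (xi x - grad (phi n) x) i ord0) =
      (fun x => xi x i ord0 - grad (phi n) x i ord0).
    by apply/funext => x; rewrite [LHS]mxE; congr (_ + _); rewrite [LHS]mxE.
  exact: measurable_funB.
pose G x := 8 * C ^+ 2 * (1 + enorm x ^+ 2).
have iG : mu.-integrable setT (EFin \o G).
  apply: integrableZ_real; apply: integrableD_real.
    exact: integrable_cst_prob.
  exact: P2_integrable_sqr_enorm.
have sqC (a e : R) : 0 <= a -> 0 <= e -> a <= C * (1 + e) ->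
    a ^+ 2 <= 2 * C ^+ 2 * (1 + e ^+ 2).
  move=> a0 e0 aC; have : a ^+ 2 <= (C * (1 + e)) ^+ 2.
    by rewrite ler_pXn2r// nnegrE mulr_ge0// addr_ge0.
  move=> /le_trans; apply; rewrite -subr_ge0.
  have -> : 2 * C ^+ 2 * (1 + e ^+ 2) - (C * (1 + e)) ^+ 2 =
    C ^+ 2 * (1 - e) ^+ 2 by ring.
  by rewrite mulr_ge0// sqr_ge0.
have diffG n x : enorm (xi x - grad (phi n) x) ^+ 2 <= G x.
  apply: le_trans (sqr_enormB_le _ _) _.
  have := sqC _ _ (enorm_ge0 _) (enorm_ge0 _) (xiC x).
  have := sqC _ _ (enorm_ge0 _) (enorm_ge0 _) (gradC n x).
  by rewrite /G; lra.
have idiff n : mu.-integrable setT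
    (EFin \o (fun x => enorm (xi x - grad (phi n) x) ^+ 2)).
  apply: (le_integrable_real _ iG) => [|x]; first exact: measurable_sqr_enorm.
  by rewrite ger0_norm ?sqr_ge0.
have ixi : mu.-integrable setT (EFin \o (fun x => enorm (xi x) ^+ 2)).
  apply: (le_integrable_real _ iG) => [|x]; first exact: measurable_sqr_enorm.
  rewrite ger0_norm ?sqr_ge0//.
  apply: le_trans (sqC _ _ (enorm_ge0 _) (enorm_ge0 _) (xiC x)) _.
  have X0 : 0 <= C ^+ 2 * (1 + enorm x ^+ 2).
    by rewrite mulr_ge0 ?sqr_ge0// addr_ge0 ?sqr_ge0.
  by rewrite /G -!(mulrA _ (C ^+ 2)); lra.
split.
  split; first exact: continuous_measurable_cVcV.
  by rewrite L2normE// ltry.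
have lim0 : \int[mu]_x (enorm (xi x - grad (phi n) x) ^+ 2) @[n --> \oo] --> (0 : R).
  have -> : (0 : R) = \int[mu]_x (0 : R) by rewrite Rintegral_cst_prob.
  apply: (@cvg_Rintegral _ _ _ _ _ _ G) => //.
  - by move=> n; exact: measurable_sqr_enorm.
  - move=> x; apply: cvg_near_cst; have := grad_near x.
    apply: filterS => n ->; rewrite subrr /enorm.
    by rewrite dotr0 sqrtr0 expr0n.
  - by move=> n x; rewrite ger0_norm ?sqr_ge0.
move=> e e0; have e20 : 0 < e ^+ 2 by rewrite exprn_gt0.
have /cvgrPdist_lt/(_ _ e20)[n _ /(_ n (leqnn n)) Hn] := lim0.
exists (phi n); split; first exact: Cphi.
rewrite L2normE// lte_fin -[e]ger0_norm ?(ltW e0)// -sqrtr_sqr.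
rewrite ltr_sqrt//; apply: le_lt_trans Hn.
by rewrite sub0r normrN ler_norm.
Qed.

Lemma Cc_inftyD (phi psi : 'cV[R]_d -> R) : Cc_infty phi -> Cc_infty psi ->
  Cc_infty (fun x => phi x + psi x).
Proof.
move=> [Cphi cphi] [Cpsi cpsi].
apply: (Cc_infty_compact (compactU cphi cpsi)) => [x|n]; last exact: class_CD.
move=> x0; have [px|px] := eqVneq (phi x) 0.
  right; apply: subset_closure => /=; apply: contra x0 => /eqP ->.
  by rewrite px addr0.
by left; exact: subset_closure.
Qed.

Definition linear_form c : 'cV[R]_d -> R := fun x => dot c x.
Definition half_square k : 'cV[R]_d -> R := fun x => 2^-1 * (dot k x * dot k x).

Lemma class_C_linear_form n c : class_C n (linear_form c).
Proof.
apply: (@class_C_ext _ _ _ (fun x => \sum_i c i ord0 * x i ord0)).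
  by move=> x; rewrite /linear_form dotE.
by apply: class_C_sum => i; apply: class_CM;
  [exact: class_C_cst|exact: class_C_coord].
Qed.

Lemma class_C_half_square n k : class_C n (half_square k).
Proof.
by apply: class_CM; [exact: class_C_cst|apply: class_CM; exact: class_C_linear_form].
Qed.

Lemma is_derive_linear_form c x i :
  is_derive x (delta_mx i ord0) (linear_form c) (c i ord0).
Proof.
have ll : linear (linear_form c : 'cV[R]_d -> R).
  by move=> a u v; rewrite /linear_form dotDr dotZr.
pose l : {linear 'cV[R]_d -> R} :=
  HB.pack (linear_form c) (GRing.isLinear.Build _ _ _ _ _ ll).
have cl : continuous l by exact: (class_C_continuous (class_C_linear_form 0 c)).
have dl : differentiable l x by exact: linear_differentiable.
have Dl : 'D_(delta_mx i ord0) l x = c i ord0.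
  rewrite (deriveE _ dl) diff_lin//= /linear_form dotE (bigD1 i)//= mxE !eqxx.
  by rewrite mulr1 big1 ?addr0// => j ji; rewrite mxE (negbTE ji) mulr0.
exact: (DeriveDef (diff_derivable dl) Dl).
Qed.

Lemma is_derive_half_square k x i :
  is_derive x (delta_mx i ord0) (half_square k) (dot k x * k i ord0).
Proof.
have dk := is_derive_linear_form k x i.
apply: (is_derive_eq (is_deriveM (is_derive_cst (2^-1 : R) x _)
  (is_deriveM dk dk))).
by rewrite scaler0 addr0 /linear_form /GRing.scale/=; field.
Qed.

Lemma derive_near_cutoff (q : 'cV[R]_d -> R) x v :
  (forall i, `|x i ord0| < 1) -> 'D_v (fun y => q y * cutoff y) x = 'D_v q x.
Proof.
move=> x1; apply: near_eq_derive.
have xbox : open_box (const_mx (- 1)) (const_mx 1) x.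
  by move=> i; rewrite !mxE -ltr_norml.
have : nbhs x (open_box (const_mx (- 1)) (const_mx 1)).
  by apply: open_nbhs_nbhs; split; first exact: open_open_box.
apply: filterS => y ybox; rewrite cutoff_eq1 ?mulr1// => i.
by have := ybox i; rewrite !mxE ler_norml => /andP[/ltW -> /ltW ->].
Qed.

(** The field is the gradient of the quadratic polynomial (k . x) ^ 2 / 2 + c . x,
    truncated by dilating a fixed cutoff.  The gradient of the truncated square is
    Lipschitz and vanishes at 0, so its dilations grow at most linearly,
    uniformly in the radius. *)
Lemma Tan_affine_rank1 mu k c : Tan mu (fun x => dot k x *: k + c).
Proof.
pose q := fun y => half_square k y * cutoff y.
pose l := fun y => linear_form c y * cutoff y.
have Cq : Cc_infty q.
  by apply: Cc_infty_cutoffM => n; exact: class_C_half_square.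
have Cl : Cc_infty l.
  by apply: Cc_infty_cutoffM => n; exact: class_C_linear_form.
pose phi (n : nat) y := dilate (n.+1%:R * n.+1%:R) n.+1%:R q y
  + dilate n.+1%:R n.+1%:R l y.
have n0 n : 0 < n.+1%:R :> R by [].
have nN0 n : n.+1%:R != 0 :> R by rewrite pnatr_eq0.
have Cphi n : Cc_infty (phi n) by apply: Cc_inftyD; exact: Cc_infty_dilate.
have gradE n x i : grad (phi n) x i ord0 =
    n.+1%:R * 'D_(delta_mx i ord0) q (n.+1%:R^-1 *: x)
    + 'D_(delta_mx i ord0) l (n.+1%:R^-1 *: x).
  rewrite mxE /phi deriveD.
  - rewrite !derive_dilate; [|exact: Cc_infty_differentiable..].
    by rewrite divff// mul1r mulfK.
  - exact/diff_derivable/Cc_infty_differentiable/Cc_infty_dilate.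
  - exact/diff_derivable/Cc_infty_differentiable/Cc_infty_dilate.
have Lq i : exists L : R, 0 <= L /\
    forall x, `|'D_(delta_mx i ord0) q x| <= L * enorm x.
  have [L L0 HL] := Cc_infty_lipschitz (Cc_infty_derive (delta_mx i ord0) Cq).
  exists L; split => // x; have := HL x 0; rewrite !subr0.
  suff -> : 'D_(delta_mx i ord0) q 0 = 0 by rewrite subr0.
  rewrite derive_near_cutoff => [|j]; last by rewrite mxE normr0.
  have [_ ->] := is_derive_half_square k 0 i.
  by rewrite dotr0 mul0r.
pose L i := projT1 (cid (Lq i)).
have L0 i : 0 <= L i by rewrite /L; case: cid => ? [].
have HL i x : `|'D_(delta_mx i ord0) q x| <= L i * enorm x.
  by rewrite /L; case: cid => ? [].
have [Cg Cg0 HCg] := Cc_infty_gradient_bound Cl.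
apply: (@Tan_of_gradients mu _ phi (\sum_i (L i + Cg i))) => //.
- move=> x; apply: continuous_cV => i.
  have -> : (fun z : 'cV[R]_d => (dot k z *: k + c) i ord0) =
      (fun z => linear_form k z * k i ord0 + c i ord0).
    by apply/funext => z; rewrite [LHS]mxE; congr (_ + _); rewrite [LHS]mxE.
  suff C0 : class_C 0 (fun z => linear_form k z * k i ord0 + c i ord0).
    exact: (class_C_continuous C0).
  apply: class_CD; last exact: class_C_cst.
  by apply: class_CM; [exact: class_C_linear_form|exact: class_C_cst].
- move=> x; have := near_scaled_in_unit_box x; apply: filterS => n Hn.
  apply/matrixP => i j; rewrite ord1 gradE.
  rewrite !derive_near_cutoff//.
  have [_ ->] := is_derive_half_square k (n.+1%:R^-1 *: x) i.
  have [_ ->] := is_derive_linear_form c (n.+1%:R^-1 *: x) i.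
  rewrite dotZr !mulrA divff// mul1r [RHS]mxE; congr (_ + _).
  by rewrite [RHS]mxE.
- move=> n x; apply: le_trans (enorm_le_sum _) _.
  rewrite mulr_suml; apply: ler_sum => i _; rewrite gradE.
  apply: le_trans (ler_normD _ _) _; rewrite normrM normr_nat.
  have H1 : n.+1%:R * `|'D_(delta_mx i ord0) q (n.+1%:R^-1 *: x)| <= L i * enorm x.
    rewrite -ler_pdivlMl//; apply: le_trans (HL i _) _.
    rewrite /enorm dotZl dotZr mulrA -expr2 sqrtrM ?sqr_ge0// sqrtr_sqr.
    by rewrite ger0_norm// mulrCA.
  have H2 := HCg i (n.+1%:R^-1 *: x).
  have := L0 i; have := Cg0 i; have := enorm_ge0 x.
  by move=> e0 c0 l0; nra.
Qed.

End tangent_fields.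

(** * Dissipativity of A and of A + B *)

Section dissipativity.
Context {R : realType} {d : nat}.
Implicit Types (mu : P2 R d) (x k c : 'cV[R]_d).

(** The hyperplane is covered by countably many flat boxes of volume zero. *)
Lemma lebesgue_cV_hyperplane j (a : R) (X : set 'cV[R]_d) :
  X `<=` [set x | x j ord0 = a] -> lebesgue_cV X = 0%E.
Proof.
move=> Xa; apply/eqP; rewrite eq_le; apply/andP; split.
  apply: ereal_inf_lbound; exists setT.
  exists (fun n => \col_i (if i == j then a else - n%:R)).
  exists (fun n => \col_i (if i == j then a else n%:R)).
  split.
    move=> x /Xa/= xj.
    have : \forall n \near \oo, forall i : 'I_d, `|x i ord0| <= n%:R.
      by apply: filter_forall => i; exact: nbhs_infty_ger.
    case=> n _ /(_ n (leqnn n)) Hn; exists n => // i; rewrite !mxE.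
    by case: eqP => [->|_]; [rewrite xj lexx|rewrite -ler_norml].
  rewrite esum1// => n _; rewrite /box_volume (bigD1 j)//= !mxE eqxx subrr.
  by rewrite maxxx mul0r.
apply: le_ereal_inf_tmp => _ [D [a' [b' [_ ->]]]].
apply: esum_ge0 => n _; rewrite lee_fin; apply: prodr_ge0 => i _.
by rewrite le_max lexx.
Qed.

Lemma hyperplane_negligible mu j (a : R) : mu `<< lebesgue_cV ->
  mu [set x | x j ord0 = a] = 0%E.
Proof.
move=> ac; have mH : measurable [set x : 'cV[R]_d | x j ord0 = a].
  have := measurable_coord j measurableT (measurable_set1 a).
  by rewrite setTI.
by apply: (ac [set x | x j ord0 = a]) => // X mX; exact: lebesgue_cV_hyperplane.
Qed.

Lemma not_ae_False mu : ~ {ae mu, forall x, False}.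
Proof.
move=> [N [mN N0 sN]]; have : mu setT = 0%E.
  rewrite -N0; congr (P2_law mu _); apply/seteqP; split=> // x _.
  by apply: sN => /=.
by rewrite probability_setT => /eqP; rewrite onee_eq0.
Qed.

Lemma not_ae_coord_cst mu j (a : R) : mu `<< lebesgue_cV ->
  ~ {ae mu, forall x, x j ord0 = a}.
Proof.
move=> /(hyperplane_negligible j a) H0 aeH; apply: (@not_ae_False mu).
have aeN : {ae mu, forall x, x j ord0 <> a}.
  exists [set x : 'cV[R]_d | x j ord0 = a]; split => //.
    have := measurable_coord j measurableT (measurable_set1 a).
    by rewrite setTI.
  by move=> x /= /contrapT.
by apply: filterS2 aeH aeN => x ->.
Qed.

Lemma ae_eq0_of_integral_sqr mu (h : 'cV[R]_d -> R) :
  measurable_fun setT h ->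
  mu.-integrable setT (EFin \o (fun x => h x * h x)) ->
  \int[mu]_x (h x * h x) = 0 -> {ae mu, forall x, h x = 0}.
Proof.
move=> mh ih h0.
have mhh : measurable_fun setT (EFin \o (fun x => h x * h x)).
  by case/integrableP: ih.
have : (\int[mu]_x `|(h x * h x)%:E| = 0)%E.
  have -> : (\int[mu]_x `|(h x * h x)%:E| = \int[mu]_x (h x * h x)%:E)%E.
    by apply: eq_integral => x _; rewrite /= ger0_norm// -expr2 sqr_ge0.
  by rewrite -(fineK (integrable_fin_num measurableT ih)) [X in X%:E]h0.
move=> /(ae_eq_integral_abs _ measurableT mhh); apply: filterS => x /(_ I) /=.
by case=> /eqP; rewrite mulf_eq0 orbb => /eqP.
Qed.

Lemma integrable_linear_form mu k : mu.-integrable setT (EFin \o (linear_form k)).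
Proof.
have -> : linear_form k = (fun x => \sum_i k i ord0 * x i ord0).
  by apply/funext => x; rewrite /linear_form dotE.
apply: integrable_sum_real => i; apply: integrableZ_real.
exact: P2_integrable_coord.
Qed.

Lemma Rintegral_linear_form mu k : \int[mu]_x linear_form k x = dot k (mean mu).
Proof.
rewrite /linear_form; under eq_Rintegral do rewrite dotE.
rewrite Rintegral_sum_real => [|i]; last first.
  exact: integrableZ_real (P2_integrable_coord mu i).
rewrite dotE; apply: eq_bigr => i _; rewrite RintegralZl ?meanE//.
exact: P2_integrable_coord.
Qed.

Section from_form.
Variables (mu : P2 R d) (A B : 'M[R]_d).
Hypothesis mu_ac : mu `<< lebesgue_cV.
Hypothesis form : forall xi : 'cV[R]_d -> 'cV[R]_d,
  Tan mu xi -> ~ {ae mu, forall x, xi x = 0} ->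
  \int[mu]_x (((xi x)^T *m A *m xi x) ord0 ord0)
    + ((vint mu xi)^T *m B *m vint mu xi) ord0 ord0 <= 0.

Let quadE (P : 'M[R]_d) (u : 'cV[R]_d) : (u^T *m P *m u) ord0 ord0 = dot u (P *m u).
Proof. by rewrite /dot mulmxA. Qed.

(** The constant field c has mean c and belongs to the tangent space. *)
Lemma sum_dissipative c : dot c ((A + B) *m c) <= 0.
Proof.
have [->|c0] := eqVneq c 0; first by rewrite mulmx0 dotr0.
have TanC : Tan mu (fun=> c).
  have := Tan_affine_rank1 mu 0 c.
  by under eq_fun do rewrite scaler0 add0r.
have notae : ~ {ae mu, forall x : 'cV[R]_d, c = 0}.
  move=> H; apply: (@not_ae_False mu); apply: filterS H => x cx.
  by move: c0; rewrite cx eqxx.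
have := form TanC notae.
have -> : vint mu (fun=> c) = c.
  by apply/matrixP => i j; rewrite ord1 mxE Rintegral_cst_prob.
by rewrite Rintegral_cst_prob !quadE mulmxDl dotDr.
Qed.

Let dev k x := dot k (x - mean mu).

Let devE k x : dev k x = linear_form k x - dot k (mean mu).
Proof. by rewrite /dev dotDr dotNr. Qed.

Let measurable_dev k : measurable_fun setT (dev k).
Proof.
have -> : dev k = (fun x => linear_form k x - dot k (mean mu)).
  by apply/funext => x; rewrite devE.
apply: measurable_funB => //.
apply: continuous_measurable_cV.
exact: (class_C_continuous (class_C_linear_form 0 k)).
Qed.

Let Rintegral_dev k : \int[mu]_x dev k x = 0.
Proof.
under eq_Rintegral do rewrite devE.
rewrite (RintegralB measurableT (integrable_linear_form mu k)
  (integrable_cst_prob mu _)).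
by rewrite Rintegral_linear_form Rintegral_cst_prob subrr.
Qed.

Let integrable_dev k : mu.-integrable setT (EFin \o (dev k)).
Proof.
have := integrableD_real (integrable_linear_form mu k)
  (integrable_cst_prob mu (- dot k (mean mu))).
by apply: eq_integrable => // x _; rewrite /= devE.
Qed.

Let integrable_dev2 k : mu.-integrable setT (EFin \o (fun x => dev k x * dev k x)).
Proof.
pose S := \sum_i `|k i ord0|.
have S0 : 0 <= S by exact: sumr_ge0.
have kS (y : 'cV[R]_d) : `|dot k y| <= S * enorm y.
  rewrite dotE; apply: le_trans (ler_norm_sum _ _ _) _; rewrite mulr_suml.
  by apply: ler_sum => i _; rewrite normrM ler_wpM2l// coord_le_enorm.
apply: (@P2_integrable _ _ mu _ (S ^+ 2 * (2 + 2 * enorm (mean mu) ^+ 2))).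
  exact: measurable_funM.
move=> x; rewrite normrM -expr2.
apply: (@le_trans _ _ ((S * enorm (x - mean mu)) ^+ 2)).
  by rewrite ler_pXn2r// ?nnegrE ?mulr_ge0 ?enorm_ge0// kS.
rewrite exprMn -[leRHS](mulrA (S ^+ 2)) ler_wpM2l ?sqr_ge0//.
apply: le_trans (sqr_enormB_le _ _) _.
have := sqr_ge0 (enorm x); have := sqr_ge0 (enorm (mean mu)).
by move: (_ ^+ 2) (_ ^+ 2) => p q p0 q0; nra.
Qed.

Let nondegenerate k := ~ {ae mu, forall x, dev k x = 0}.

(** The field (k . (x - mean)) k has mean zero, which removes the term with B, and
    the form equals the variance of k . x times k . A k. *)
Lemma dissipative_nondegenerate k : nondegenerate k -> dot k (A *m k) <= 0.
Proof.
move=> ndk.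
have V0 : 0 <= \int[mu]_x (dev k x * dev k x).
  by apply: Rintegral_ge0 => x _; rewrite -expr2 sqr_ge0.
have Vpos : 0 < \int[mu]_x (dev k x * dev k x).
  rewrite lt_def V0 andbT; apply/eqP => V_eq0; apply: ndk.
  exact: ae_eq0_of_integral_sqr.
pose xi x := dev k x *: k.
have TanX : Tan mu xi.
  have := Tan_affine_rank1 mu k (- dot k (mean mu) *: k).
  congr (Tan _ _); apply/funext => x; rewrite /xi devE /linear_form.
  by rewrite scalerDl.
have k0 : k != 0.
  apply/eqP => k0; apply: ndk; apply: aeW => x.
  by rewrite /dev k0 dotC dotr0.
have notae : ~ {ae mu, forall x, xi x = 0}.
  move=> H; apply: ndk; apply: filterS H => x /eqP.
  by rewrite /xi scaler_eq0 (negbTE k0) orbF => /eqP.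
have := form TanX notae.
have -> : vint mu xi = 0.
  apply/matrixP => i j; rewrite ord1 !mxE /xi.
  under eq_Rintegral do rewrite mxE.
  by rewrite RintegralZr// Rintegral_dev mul0r.
have -> : \int[mu]_x (((xi x)^T *m A *m xi x) ord0 ord0) =
    \int[mu]_x (dev k x * dev k x) * dot k (A *m k).
  rewrite -RintegralZr//; apply: eq_Rintegral => x _.
  by rewrite quadE /xi -scalemxAr dotZl dotZr mulrA.
by rewrite mulmx0 mxE addr0 pmulr_rle0.
Qed.

(** If both k . x and (k + s e_j) . x were almost surely constant, the coordinate
    x_j would be as well, and mu would charge a hyperplane. *)
Lemma nondegenerate_shift k j (s : R) : s != 0 -> ~ nondegenerate k ->
  nondegenerate (k + s *: delta_mx j ord0).
Proof.
move=> s0 /contrapT aek aeks.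
apply: (@not_ae_coord_cst mu j (mean mu j ord0) mu_ac).
apply: filterS2 aek aeks => x; rewrite /dev dotDl dotZl => ->.
rewrite add0r => /eqP; rewrite mulf_eq0 (negbTE s0)/= dotE (bigD1 j)//=.
rewrite mxE !eqxx mul1r big1 => [|i /negbTE ij].
  by rewrite addr0 [X in X == _]mxE [X in _ + X]mxE subr_eq0 => /eqP.
by rewrite mxE ij mul0r.
Qed.

(** A direction k along which mu is degenerate is a limit of directions
    k + s e_j along which it is not. *)
Lemma matrix_dissipative k : dot k (A *m k) <= 0.
Proof.
have [->|/cV0Pn[j _]] := eqVneq k 0; first by rewrite mulmx0 dotr0.
have [ndk|dk] := pselect (nondegenerate k); first exact: dissipative_nondegenerate.
pose e : 'cV[R]_d := delta_mx j ord0.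
have H s : s != 0 ->
    dot k (A *m k) + s * (dot k (A *m e) + dot e (A *m k))
      + s ^+ 2 * dot e (A *m e) <= 0.
  move=> s0; have := dissipative_nondegenerate (@nondegenerate_shift k j s s0 dk).
  rewrite mulmxDr -scalemxAr !(dotDl, dotDr, dotZl, dotZr) -/e.
  set p := dot k (A *m k); set q := dot k _; set r := dot e _; set u := dot e _.
  suff -> : p + s * q + s * (r + s * u) = p + s * (q + r) + s ^+ 2 * u by [].
  by ring.
(* Averaging the inequalities for s and - s leaves p + s ^ 2 u <= 0, which
   fails for p > 0 when s is small. *)
rewrite leNgt; apply/negP => p0.
set p := dot k (A *m k) in H p0; set q := _ + _ in H; set u := dot e _ in H.
have u1 : 0 < `|u| + 1 by rewrite ltr_wpDl.
pose s := Num.min 1 (p / (2 * (`|u| + 1))).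
have s0 : 0 < s by rewrite lt_min ltr01 divr_gt0// mulr_gt0.
have s1 : s <= 1 by rewrite ge_min lexx.
have sp : s * (`|u| + 1) <= p / 2.
  rewrite -ler_pdivlMr// (le_trans (_ : s <= p / (2 * (`|u| + 1))))//.
    by rewrite ge_min lexx orbT.
  by rewrite invfM mulrA.
have Hp := H s (lt0r_neq0 s0).
have Hm : p + - s * q + (- s) ^+ 2 * u <= 0 by apply: H; rewrite oppr_eq0 lt0r_neq0.
have : p + s ^+ 2 * u <= 0 by move: Hp Hm; rewrite sqrrN; lra.
have : - (s * (`|u| + 1)) <= s ^+ 2 * u.
  have := ler_norm (- u); rewrite normrN => ?.
  have := normr_ge0 u => ?.
  have : s ^+ 2 <= s by rewrite expr2 ler_piMr// ltW.
  have : 0 <= s ^+ 2 by exact: sqr_ge0.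
  move: (s ^+ 2) => s2 s20 s2s; nra.
by move=> ? ?; lra.
Qed.

End from_form.

End dissipativity.

(** * Contraction of the Wasserstein distance *)

Section contraction.
Context {R : realType} {d : nat}.
Variables (A B : 'M[R]_d) (f : 'cV[R]_d -> P2 R d -> 'cV[R]_d).
Hypothesis f_def : forall x m, f x m = A *m x + vint m (fun y => B *m y).
Hypothesis A_le0 : forall k : 'cV[R]_d, dot k (A *m k) <= 0.
Hypothesis AB_le0 : forall k : 'cV[R]_d, dot k ((A + B) *m k) <= 0.

(** Push an almost optimal coupling of the initial laws by both affine flows.  The
    difference z of two points becomes exp (t A) (z - zb) + exp (t (A + B)) zb,
    where zb is the mean of z.  Both exponentials are contractions, and the cross
    terms are linear in z - zb, so that they have integral zero: the cost does
    not increase. *)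
Lemma W2_solutions_le (m1 m2 : R -> P2 R d) (t s : R) :
  solution f m1 -> solution f m2 -> 0 <= t -> W2 (m1 0) (m2 0) < s ->
  W2 (m1 t) (m2 t) < s.
Proof.
move=> sol1 sol2 t0 Ws.
have s0 : 0 < s by exact: le_lt_trans (W2_ge0 _ _) Ws.
have [gamma cg gs] := W2_lt_coupling Ws.
pose F1 := solution_flow A B m1 t; pose F2 := solution_flow A B m2 t.
have mF1 : measurable_fun setT F1.
  by apply: continuous_measurable_cVcV; exact: solution_flow_continuous.
have mF2 : measurable_fun setT F2.
  by apply: continuous_measurable_cVcV; exact: solution_flow_continuous.
pose F (z : 'cV[R]_d * 'cV[R]_d) := (F1 z.1, F2 z.2).
have mF : measurable_fun setT F.
  apply: measurable_fun_pair.
    exact: (measurableT_comp mF1 measurable_fst).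
  exact: (measurableT_comp mF2 measurable_snd).
pose mFm : {mfun _ >-> _} := HB.pack F (isMeasurableFun.Build _ _ _ _ _ mF).
pose gammat : probability ('cV[R]_d * 'cV[R]_d)%type R := distribution gamma mFm.
have cgt : coupling (m1 t) (m2 t) gammat.
  move=> E mE; split.
    rewrite -(solution_law f_def sol1 t0 mE) -(coupling_fst cg).
      rewrite /gammat /= /distribution /pushforward; congr (gamma _).
      by apply/seteqP; split=> -[x y] //= [].
    by have := mF1 measurableT E mE; rewrite setTI.
  rewrite -(solution_law f_def sol2 t0 mE) -(coupling_snd cg).
    rewrite /gammat /= /distribution /pushforward; congr (gamma _).
    by apply/seteqP; split=> -[x y] //= [].
  by have := mF2 measurableT E mE; rewrite setTI.
pose c := \int[gamma]_z (enorm (z.1 - z.2) ^+ 2).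
suff ct : \int[gammat]_z (enorm (z.1 - z.2) ^+ 2) <= c.
  apply: le_lt_trans (W2_le_coupling cgt ct) _.
  by rewrite -[s]ger0_norm ?(ltW s0)// -sqrtr_sqr ltr_sqrt// exprn_gt0.
have -> : \int[gammat]_z (enorm (z.1 - z.2) ^+ 2) =
    \int[gamma]_z (enorm (F1 z.1 - F2 z.2) ^+ 2).
  by rewrite -(@Rintegral_law _ _ _ _ R gamma gammat F mF (fun E _ => erefl)
    (fun z => enorm (z.1 - z.2) ^+ 2) (coupling_integrable_cost cgt)).
(* The cost is increased pointwise by at most l . (z - zb), where l collects the
   cross terms; this has integral zero. *)
pose zb := mean (m1 0) - mean (m2 0).
pose E := mexp A t; pose G := mexp (A + B) t.
pose l := 2 *: (E^T *m (G *m zb) - zb).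
have pointwise x y : enorm (F1 x - F2 y) ^+ 2 <=
    enorm (x - y) ^+ 2 + (linear_form l x - linear_form l y - dot l zb).
  pose u := x - y - zb.
  have -> : F1 x - F2 y = E *m u + G *m zb.
    rewrite /F1 /F2 /solution_flow -/E -/G opprD addrACA -mulmxBr -mulmxBr.
    congr (_ *m _ + _); rewrite /u /zb !opprD !opprK.
    by rewrite addrACA -!addrA; congr (_ + _); rewrite addrCA.
  have -> : linear_form l x - linear_form l y - dot l zb = dot l u.
    have dot3 (a b e : 'cV[R]_d) : dot l a - dot l b - dot l e = dot l (a - b - e).
      by rewrite !dotDr !dotNr.
    exact: dot3.
  have -> : x - y = u + zb by rewrite /u subrK.
  have Eu := mexp_contraction u A_le0 t0; rewrite -/E in Eu.
  have Gz := mexp_contraction zb AB_le0 t0; rewrite -/G in Gz.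
  have sqrD (a b : 'cV[R]_d) :
      enorm (a + b) ^+ 2 = dot a a + 2 * dot a b + dot b b.
    by rewrite sqr_enorm !(dotDl, dotDr) (dotC b a); ring.
  rewrite !sqrD.
  have -> : dot l u = 2 * dot (E *m u) (G *m zb) - 2 * dot u zb.
    rewrite /l dotZl dotDl dotNl mulrBr (dotC zb u); congr (_ * _ - _).
    by rewrite [LHS]dotC /dot trmx_mul -(mulmxA u^T).
  by lra.
have i1 := coupling_integrable_fst cg (integrable_linear_form (m1 0) l).
have i2 := coupling_integrable_snd cg (integrable_linear_form (m2 0) l).
have ic := coupling_integrable_cost cg.
have i12 : gamma.-integrable setT (EFin \o (fun z : 'cV[R]_d * 'cV[R]_d =>
    linear_form l z.1 - linear_form l z.2)).
  have := integrableD_real i1 (integrableZ_real (-1) i2).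
  by apply: eq_integrable => // z _; rewrite /= mulN1r.
have i123 : gamma.-integrable setT (EFin \o (fun z : 'cV[R]_d * 'cV[R]_d =>
    linear_form l z.1 - linear_form l z.2 - dot l zb)).
  exact: (integrableD_real i12 (integrable_cst_prob gamma (- dot l zb))).
have zero : \int[gamma]_z (linear_form l z.1 - linear_form l z.2 - dot l zb) = 0.
  rewrite RintegralB//; last exact: integrable_cst_prob.
  rewrite Rintegral_cst_prob RintegralB//.
  rewrite (coupling_Rintegral_fst cg (integrable_linear_form (m1 0) l)).
  rewrite (coupling_Rintegral_snd cg (integrable_linear_form (m2 0) l)).
  by rewrite !Rintegral_linear_form /zb dotDr dotNr subrr.
apply: (@le_trans _ _ (\int[gamma]_z (enorm (z.1 - z.2) ^+ 2
    + (linear_form l z.1 - linear_form l z.2 - dot l zb)))).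
  apply: le_Rintegral => //.
  - have := integrable_law mF (P := gamma) (mu := gammat) (fun E _ => erefl)
      (coupling_integrable_cost cgt).
    by apply: eq_integrable.
  - exact: integrableD_real.
by rewrite RintegralD// zero addr0.
Qed.

End contraction.

Unset Implicit Arguments.

Theorem theorem4p4 (R : realType) (d : nat) (A B : 'M[R]_d)
    (f : 'cV[R]_d -> P2 R d -> 'cV[R]_d)
    (f_def : forall x m, f x m = A *m x + vint m (fun y => B *m y))
    (f_lip : lipschitz_field f)
    (mhat : P2 R d)
    (mhat_eq : equilibrium f mhat)
    (mhat_ac : mhat `<< lebesgue_cV)
    (mhat_form : forall xi : 'cV[R]_d -> 'cV[R]_d,
       Tan mhat xi -> ~ {ae mhat, forall x, xi x = 0} ->
       \int[mhat]_x (((xi x)^T *m A *m xi x) ord0 ord0)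
         + ((vint mhat xi)^T *m B *m vint mhat xi) ord0 ord0 <= 0) :
  stable f mhat.
Proof.
move=> eps eps0; exists eps => // mstar t m Ws t0 sol m0.
rewrite -m0 in Ws.
apply: (W2_solutions_le f_def _ _ mhat_eq sol (ltW t0) Ws).
- exact: matrix_dissipative mhat_ac mhat_form.
- exact: sum_dissipative mhat_form.
Qed.
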